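(* Fix $\lambda,\sigma>0$ and let $\tilde d$ be the metric on $\mathbb{R}^2\times S^1$ obtained from the Gabor family with the Gabor patches, and $\mu$ the spherical Hausdorff measure of $\tilde d$. Then the metric measure space $(\mathbb{R}^2\times S^1,\tilde d,\mu)$ satisfies the weak Measure Contraction Property (without exceptional set).
   Context: Gabor family: for $p=(x,y,\theta)\in\mathbb{R}^2\times S^1$, $\psi_p(u,v)=\psi_0(R_{-\theta}(u-x,v-y))$ with $\psi_0(u,v)=\exp(2\pi iu/\lambda)\exp(-\frac{u^2+v^2}{2\sigma^2})$, $R_\alpha$ rotation by $\alpha$; $d(p,q)=\|\psi_p-\psi_q\|_{L^2(\mathbb{R}^2)}$. Gabor patch around $p_0=(x_0,y_0,\theta_0)$: $\mathcal{P}(p_0)=\{(x,y,\theta): |a(1+\cos(\theta-\theta_0))+b\sin(\theta-\theta_0)|<\lambda,\ (a,b)=R_{-\theta_0}(x-x_0,y-y_0)\}$. Then $\tilde d(p,p_0):=\inf\{\sum_{j=1}^N d(q_{j-1},q_j): N\in\mathbb{N}, q_0=p_0, q_N=p, q_j\in\mathcal{P}(q_{j-1})\ \forall j\}$. The spherical Hausdorff measure is taken in the Hausdorff dimension of the space. Weak Measure Contraction Property (MCP): a metric measure space $(X,d,\mu)$ ($(X,d)$ locally compact separable, $\mu$ Radon, strictly positive on nonempty open sets) satisfies it with exceptional set $Z$ ($Z$ closed, $\mu(Z)=0$) if for every compact $Y\subseteq X\setminus Z$ there exist $R>0$, $\Theta<\infty$, $\vartheta<\infty$ and $\mu\otimes\mu$-measurable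 maps $\Phi_t:X\times X\to X$, $t\in[0,1]$, with: (i) for $\mu$-a.e. $x,y\in Y$ with $d(x,y)<R$ and all $s,t\in[0,1]$: $\Phi_0(x,y)=x$, $\Phi_t(x,y)=\Phi_{1-t}(y,x)$, $\Phi_s(x,\Phi_t(x,y))=\Phi_{st}(x,y)$, $d(\Phi_s(x,y),\Phi_t(x,y))\le\vartheta|s-t|d(x,y)$; (ii) with $d\mu_r(x)=d\mu(x)/\sqrt{\mu(B_r(x))}$, for all $0<r<R$, $\mu$-a.e. $x\in Y$, all $\mu$-measurable $A\subseteq B_r(x)\cap Y$ and all $t\in(0,1]$: $\frac{\mu_r(A)}{\sqrt{\mu(B_r(x))}}\le\Theta\frac{\mu_{rt}(\Phi_t(x,A))}{\sqrt{\mu(B_{rt}(x))}}$. ''Without exceptional set'' means $Z=\emptyset$. *)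

(* Defs.v *)
From HB Require Import structures.
From mathcomp Require Import all_boot all_order all_algebra.
From mathcomp Require Import all_classical all_reals all_analysis.
Set Implicit Arguments.
Unset Strict Implicit.
Unset Printing Implicit Defensive.
Import Order.TTheory GRing.Theory Num.Theory.
Local Open Scope ring_scope.
Local Open Scope classical_set_scope.

Section cover_ext.
Local Open Scope ereal_scope.
Context (R : realType) (T : Type).
Variables (G : set (set T)) (c : set T -> \bar R).
Hypotheses (G0 : G set0) (c0 : c set0 = 0) (c_ge0 : forall A, 0 <= c A).

Definition gcover (A : set T) := [set F : (set T)^nat |
  (forall k, G (F k)) /\ A `<=` \bigcup_k (F k)].

Definition cover_ext (A : set T) : \bar R :=
  ereal_inf [set \sum_(k <oo) c (F k) | F in gcover A].

Lemma le_cover_ext : {homo cover_ext : A B / A `<=` B >-> A <= B}.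
Proof.
move=> A B AB; apply/ereal_inf_le_tmp => x [B' [mB' BB']].
by move=> <-{x}; exists B' => //; split => //; apply: subset_trans AB BB'.
Qed.

Lemma cover_ext_ge0 A : 0 <= cover_ext A.
Proof.
apply: le_ereal_inf_tmp => x [B [mB AB] <-{x}]; exact: nneseries_ge0.
Qed.

Lemma cover_ext0 : cover_ext set0 = 0.
Proof.
apply/eqP; rewrite eq_le; apply/andP; split; last exact/cover_ext_ge0.
rewrite /cover_ext; apply: ereal_inf_lbound; exists (fun=> set0); first by split.
by rewrite eseries0.
Qed.

Lemma cover_ext_sigma_subadditive : sigma_subadditive cover_ext.
Proof.
move=> A; have [[i ioo]|] := pselect (exists i, cover_ext (A i) = +oo).
  rewrite (eseries_pinfty _ _ ioo) ?leey// => n _.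
  by rewrite -ltNye (lt_le_trans _ (cover_ext_ge0 _)).
rewrite -forallNE => Aoo.
suff add2e (e : {posnum R}) :
    cover_ext (\bigcup_n A n) <= \sum_(i <oo) cover_ext (A i) + e%:num%:E.
  by apply/lee_addgt0Pr => _/posnumP[].
rewrite (le_trans _ (epsilon_trick _ _ _))//; last first.
  by move=> n; exact: cover_ext_ge0.
pose P n (B : (set T)^nat) := gcover (A n) B /\
  \sum_(k <oo) c (B k) <= cover_ext (A n) + (e%:num / (2 ^ n.+1)%:R)%:E.
have [H PH] : {H : ((set T)^nat)^nat & forall n, P n (H n)}.
  apply: (@choice _ _ P) => n; rewrite /P /cover_ext.
  set S := (X in ereal_inf X); move infS : (ereal_inf S) => iS.
  case: iS infS => [r Sr|Soo|Soo].
  - have en1 : (0 < e%:num / (2 ^ n.+1)%:R)%R by [].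
    have /(lb_ereal_inf_adherent en1) : ereal_inf S \is a fin_num by rewrite Sr.
    move=> [x [B [mB AnB muBx] xS]].
    by exists B; split => //; rewrite muBx -Sr; exact/ltW.
  - by have := Aoo n; rewrite /cover_ext Soo.
  - suff : lbound S 0 by move/le_ereal_inf_tmp; rewrite Soo.
    by move=> /= _ [B [mB AnB] <-]; exact: nneseries_ge0.
have muG_ge0 x : 0 <= (c \o uncurry H) x by exact: c_ge0.
apply: (@le_trans _ _ (\esum_(i in setT) (c \o uncurry H) i)).
  rewrite /cover_ext; apply: ereal_inf_lbound => /=.
  have /card_esym/ppcard_eqP[f] := card_nat2.
  exists (uncurry H \o f).
    split => [i|]; first by rewrite /=; case: (f i) => a b; exact: (PH a).1.1.
    apply: (@subset_trans _  (\bigcup_n \bigcup_k H n k)) => [t [i _]|].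
      by move=> /((PH i).1.2) -[j _ ?]; exists i => //; exists j.
    move=> t [i _ [j _ Bijt]]; exists (f^-1%FUN (i, j)) => //=.
    by rewrite invK ?inE.
  rewrite -(esum_pred_image (c \o uncurry H) _ xpredT) ?[fun=> _]set_true//.
  by rewrite image_eq.
rewrite (_ : esum _ _ = \sum_(i <oo) \sum_(j <oo ) c (H i j)); last first.
  pose J : nat -> set (nat * nat) := fun i => [set (i, j) | j in setT].
  rewrite (_ : setT = \bigcup_k J k); last first.
    by rewrite predeqE => -[a b]; split => // _; exists a => //; exists b.
  rewrite esum_bigcupT /=; last 2 first.
    - apply/trivIsetP => i j _ _ ij.
      rewrite predeqE => -[n m] /=; split => //= -[] [_] _ [<-{n} _].
      by move=> [m' _] [] /esym/eqP; rewrite (negbTE ij).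
    - by move=> /= [n m]; apply: c_ge0.
  rewrite -(image_id [set: nat]) -fun_true esum_pred_image//; last first.
    by move=> n _; exact: esum_ge0.
  apply: eq_eseriesr => /= j _.
  rewrite -(esum_pred_image (c \o uncurry H) (pair j) predT)//=; last first.
    by move=> ? ? _ _; exact: (@can_inj _ _ _ snd).
  by congr esum; rewrite predeqE => -[a b]; split; move=> [i _ <-]; exists i.
apply: lee_lim.
- apply: is_cvg_nneseries => n *.
  by apply: nneseries_ge0 => m *; exact: (muG_ge0 (n, m)).
- by apply: is_cvg_nneseries => n *; apply: adde_ge0 => //; exact: cover_ext_ge0.
- by near=> n; apply: lee_sum => i _; exact: (PH i).2.
Unshelve. all: by end_near. Qed.

End cover_ext.

(* The supremum over delta > 0 of covering outer measures (delta -> 0 limit, *)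
(* the approximations being nonincreasing in delta).                         *)
Section sup_cover.
Local Open Scope ereal_scope.
Context (R : realType) (T : Type).
Variables (G : R -> set (set T)) (c : set T -> \bar R).

Definition sup_cover (A : set T) : \bar R :=
  ereal_sup [set cover_ext (G delta) c A | delta in [set delta : R | (0 < delta)%R]].

Hypotheses (G0 : forall delta, G delta set0) (c0 : c set0 = 0)
  (c_ge0 : forall A, 0 <= c A).

Lemma sup_cover_ge0 A : 0 <= sup_cover A.
Proof.
apply: (le_trans (cover_ext_ge0 (G 1) c_ge0 A)); apply: ereal_sup_ubound.
by exists 1%R => //=; rewrite ltr01.
Qed.

Lemma sup_cover0 : sup_cover set0 = 0.
Proof.
apply/eqP; rewrite eq_le sup_cover_ge0 andbT; apply: ub_ereal_sup.
by move=> _ [delta _ <-]; rewrite cover_ext0.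
Qed.

Lemma le_sup_cover : {homo sup_cover : A B / A `<=` B >-> A <= B}.
Proof.
move=> A B AB; apply: ub_ereal_sup => _ [delta d0 <-].
apply: (le_trans (le_cover_ext (G delta) c AB)); apply: ereal_sup_ubound.
by exists delta.
Qed.

Lemma sup_cover_sigma_subadditive : sigma_subadditive sup_cover.
Proof.
move=> A; apply: ub_ereal_sup => _ [delta d0 <-].
apply: (le_trans (cover_ext_sigma_subadditive (G delta) c_ge0 A)).
apply: lee_nneseries => n _; first by move=> _; exact: (cover_ext_ge0 _ c_ge0).
by apply: ereal_sup_ubound; exists delta.
Qed.

End sup_cover.

Section metric_notions.
Local Open Scope ereal_scope.
Context (R : realType) (T : Type) (d : T -> T -> \bar R).

Definition dball (x : T) (r : R) : set T := [set y | d x y < r%:E].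

Definition dopen (U : set T) : Prop :=
  forall x, U x -> exists r : R, (0 < r)%R /\ dball x r `<=` U.

Definition dclosed (Z : set T) : Prop := dopen (~` Z).

Definition dcompact (K : set T) : Prop :=
  forall F : set (set T), (forall U, F U -> dopen U) ->
    K `<=` \bigcup_(U in F) U ->
    exists F' : set (set T), [/\ F' `<=` F, finite_set F' &
                                 K `<=` \bigcup_(U in F') U].

Definition dborel : set (set T) := smallest (sigma_algebra setT) dopen.

Definition is_metric : Prop :=
  [/\ forall x y, d x y \is a fin_num,
      forall x y, d x y = 0 <-> x = y,
      forall x y, d x y = d y x &
      forall x y z, d x z <= d x y + d y z].

Definition locally_compact : Prop :=
  forall x, exists r : R, (0 < r)%R /\
    exists K, dcompact K /\ dball x r `<=` K.

Definition separable : Prop :=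
  exists D : set T, countable D /\
    forall x (e : R), (0 < e)%R -> exists y, D y /\ d x y < e%:E.

Definition diam (A : set T) : \bar R :=
  ereal_sup [set d xy.1 xy.2 | xy in A `*` A].

Definition radon (mu : set T -> \bar R) : Prop :=
  [/\ forall B, dborel B -> mu.-caratheodory B,
      forall A, exists B, [/\ dborel B, A `<=` B & mu A = mu B] &
      forall K, dcompact K -> mu K < +oo].

Definition positive_on_open (mu : set T -> \bar R) : Prop :=
  forall U, dopen U -> U !=set0 -> 0 < mu U.

Definition mm_space (mu : set T -> \bar R) : Prop :=
  [/\ is_metric, locally_compact, separable, radon mu & positive_on_open mu].

Definition hcost (s : R) (C : set T) : \bar R :=
  if C == set0 then 0 else ((fine (diam C)) `^ s)%:E.

Lemma hcost0 s : hcost s set0 = 0.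
Proof. by rewrite /hcost eqxx. Qed.

Lemma hcost_ge0 s C : 0 <= hcost s C.
Proof. by rewrite /hcost; case: ifP => // _; rewrite lee_fin powR_ge0. Qed.

Definition haus_family (delta : R) : set (set T) :=
  [set C | diam C <= delta%:E].
Definition sph_family (delta : R) : set (set T) :=
  [set C | C = set0 \/
           ((exists x (r : R), (0 < r)%R /\ C = dball x r) /\ diam C <= delta%:E)].

Definition hausdorff (s : R) : set T -> \bar R :=
  sup_cover haus_family (hcost s).

Definition sph_haus (s : R) : set T -> \bar R :=
  sup_cover sph_family (hcost s).

Definition hausdorff_dim : \bar R :=
  ereal_inf [set s%:E | s in [set s : R | (0 <= s)%R /\ hausdorff s setT = 0]].

End metric_notions.

Section sph_haus_outer.
Context (R : realType) (T : Type) (d : T -> T -> \bar R) (s : R).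

Let G0 delta : sph_family d delta set0. Proof. by left. Qed.

HB.instance Definition _ := isOuterMeasure.Build R T (sph_haus d s)
  (sup_cover0 G0 (hcost0 d s) (hcost_ge0 d s))
  (sup_cover_ge0 _ (hcost_ge0 d s))
  (le_sup_cover _ _)
  (sup_cover_sigma_subadditive _ (hcost_ge0 d s)).

End sph_haus_outer.

Section weak_mcp.
Local Open Scope ereal_scope.
Context (R : realType) (T : pointedType) (d : T -> T -> \bar R).
Variable mu : {outer_measure set T -> \bar R}.

Definition inv_sqrt_ball (r : R) (y : T) : \bar R :=
  match mu (dball d y r) with
  | m%:E => if (0 < m)%R then ((Num.sqrt m)^-1)%:E else +oo
  | +oo => 0
  | -oo => +oo
  end.

Definition mu_r (r : R) (A : set T) : \bar R :=
  (* integral w.r.t. the measure induced by mu on its Caratheodory sets *)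
  \int[(mu : set (caratheodory_type mu) -> \bar R)]_(y in A) inv_sqrt_ball r y.

Definition prod_outer (E : set (T * T)) : \bar R :=
  ereal_inf [set e | exists A B : (set T)^nat,
    [/\ forall k, mu.-caratheodory (A k) /\ mu.-caratheodory (B k),
        E `<=` \bigcup_k (A k `*` B k) &
        e = \sum_(k <oo) (mu (A k) * mu (B k))]].

Definition prod_measurable (F : T * T -> T) : Prop :=
  forall U, dborel d U -> prod_outer.-caratheodory (F @^-1` U).

Definition weak_MCP (Z : set T) : Prop :=
  [/\ mm_space d mu, dclosed d Z, mu Z = 0 &
  forall Y : set T, dcompact d Y -> Y `<=` ~` Z ->
  exists (Rr Theta vartheta : R) (Phi : R -> T -> T -> T),
  [/\ (0 < Rr)%R,
      forall t : R, (0 <= t <= 1)%R -> prod_measurable (uncurry (Phi t)),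
      (exists N : set (T * T), prod_outer N = 0 /\
        forall x y, Y x -> Y y -> ~ N (x, y) -> d x y < Rr%:E ->
        forall s t : R, (0 <= s <= 1)%R -> (0 <= t <= 1)%R ->
        [/\ Phi 0%R x y = x,
            Phi t x y = Phi (1 - t)%R y x,
            Phi s x (Phi t x y) = Phi (s * t)%R x y &
            d (Phi s x y) (Phi t x y) <= (vartheta * `|s - t|)%:E * d x y]) &
      forall r : R, (0 < r < Rr)%R ->
        exists N : set T, mu N = 0 /\
        forall x, Y x -> ~ N x ->
        forall A : set T, mu.-caratheodory A -> A `<=` dball d x r `&` Y ->
        forall t : R, (0 < t <= 1)%R ->
        mu_r r A * inv_sqrt_ball r x
          <= Theta%:E * (mu_r (r * t) (Phi t x @` A) * inv_sqrt_ball (r * t) x)]].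

End weak_mcp.

Section gabor.
Local Open Scope ereal_scope.
Context (R : realType).

(* S^1 as the unit circle; theta is represented by (cos theta, sin theta) *)
Definition S1 := {p : R * R | (p.1 ^+ 2 + p.2 ^+ 2 == 1)%R}.
HB.instance Definition _ := Choice.copy S1 {p : R * R | (p.1 ^+ 2 + p.2 ^+ 2 == 1)%R}.
Lemma S1_pt_proof : ((1:R) ^+ 2 + (0:R) ^+ 2 == 1)%R.
Proof. by rewrite expr1n expr0n addr0. Qed.
HB.instance Definition _ := isPointed.Build S1 (exist _ (1%R, 0%R) S1_pt_proof).

Definition RRS1 := (R * R * S1)%type.
HB.instance Definition _ := Choice.copy RRS1 (R * R * S1)%type.
HB.instance Definition _ :=
  isPointed.Build RRS1 ((0%R, 0%R), exist _ (1%R, 0%R) S1_pt_proof).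
Definition px (p : RRS1) : R := p.1.1.
Definition py (p : RRS1) : R := p.1.2.
Definition cth (p : RRS1) : R := (sval p.2).1.
Definition sth (p : RRS1) : R := (sval p.2).2.

(* psi_p(u,v) = psi_0(R_{-theta}(u - x, v - y)), split into real and
   imaginary parts; R_{-theta}(U,V) = (cos th U + sin th V, - sin th U + cos th V),
   psi_0(a,b) = exp(2 pi i a / lambda) exp(-(a^2+b^2)/(2 sigma^2)). *)
Definition gabor_arg (p : RRS1) (z : R * R) : R * R :=
  let U := (z.1 - px p)%R in let V := (z.2 - py p)%R in
  ((cth p * U + sth p * V)%R, (- sth p * U + cth p * V)%R).

Definition gabor_re (lam sig : R) (p : RRS1) (z : R * R) : R :=
  let ab := gabor_arg p z in
  (cos (2 * pi * ab.1 / lam) * expR (- (ab.1 ^+ 2 + ab.2 ^+ 2) / (2 * sig ^+ 2)))%R.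

Definition gabor_im (lam sig : R) (p : RRS1) (z : R * R) : R :=
  let ab := gabor_arg p z in
  (sin (2 * pi * ab.1 / lam) * expR (- (ab.1 ^+ 2 + ab.2 ^+ 2) / (2 * sig ^+ 2)))%R.

(* d(p,q) = || psi_p - psi_q ||_{L^2(R^2)}; |w|^2 = (Re w)^2 + (Im w)^2 *)
Definition gabor_dist (lam sig : R) (p q : RRS1) : R :=
  Num.sqrt (fine (\int[(@lebesgue_measure R) \x (@lebesgue_measure R)]_z
    (((gabor_re lam sig p z - gabor_re lam sig q z) ^+ 2 +
      (gabor_im lam sig p z - gabor_im lam sig q z) ^+ 2)%R)%:E)).

Definition gabor_patch (lam : R) (p0 p : RRS1) : Prop :=
  let a := (cth p0 * (px p - px p0) + sth p0 * (py p - py p0))%R in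
  let b := (- sth p0 * (px p - px p0) + cth p0 * (py p - py p0))%R in
  let cos_diff := (cth p * cth p0 + sth p * sth p0)%R in
  let sin_diff := (sth p * cth p0 - cth p * sth p0)%R in
  (`| a * (1 + cos_diff) + b * sin_diff | < lam)%R.

Definition gabor_dtilde (lam sig : R) (p p0 : RRS1) : \bar R :=
  ereal_inf [set e | exists (N : nat) (q : nat -> RRS1),
    [/\ q 0%N = p0, q N = p,
        forall j, (j < N)%N -> gabor_patch lam (q j) (q j.+1) &
        e = (\sum_(j < N) gabor_dist lam sig (q j) (q j.+1))%:E]].

Definition gabor_mu (lam sig : R) : {outer_measure set RRS1 -> \bar R} :=
  sph_haus (gabor_dtilde lam sig) (fine (hausdorff_dim (gabor_dtilde lam sig))).

End gabor.

(* Main.v *)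
Require Import Defs.
From HB Require Import structures.
From mathcomp Require Import all_boot all_order all_algebra finmap.
From mathcomp Require Import all_classical all_reals all_analysis.
From mathcomp Require Import measurable_realfun ring lra.
Set Implicit Arguments.
Unset Strict Implicit.
Unset Printing Implicit Defensive.
Import Order.TTheory GRing.Theory Num.Theory.
Import numFieldNormedType.Exports.
Local Open Scope ring_scope.
Local Open Scope classical_set_scope.

(**
Write cdist p q for the l1 distance of the vectors (x, y, cos theta, sin theta)
attached to p and q. The squared modulus of psi_p - psi_q equals
(A - B)^2 + 2 A B (1 - cos (phase difference)), where A and B are the two
Gaussian envelopes. Bounding this from above by a multiple of
(cdist p q)^2 (A + B), and from below on a small square next to the centre of
psi_p, gives c min(cdist, 1) <= d everywhere and d <= C cdist when cdist <= 1.
Since min(cdist, 1) is a metric, the lower bound survives the infimum over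
chains, and since patches contain cdist-neighbourhoods so does the upper one:
the metric of the theorem is locally bi-Lipschitz to cdist.

Everything else uses only this. The space is locally Euclidean of dimension
three, so comparing with Lebesgue measure in charts shows that the Hausdorff
dimension is 3 and that balls of small radius r have measure between c r^3 and
C r^3. For Phi_t take affine interpolation of positions and of angles along the
shorter arc. It expands distances backwards by at most a factor of order 1/t,
so mu A <= (const / t)^3 mu (Phi_t(x, A)), which is the contraction inequality.
*)

(** * Metric outer measures *)

Section metric_facts.
Context (R : realType) (T : Type) (d : T -> T -> \bar R) (dm : is_metric d).

Definition rdist (x y : T) : R := fine (d x y).

Lemma rdistE x y : d x y = (rdist x y)%:E.
Proof. by case: dm => /(_ x y) f _ _ _; rewrite /rdist fineK. Qed.

Lemma rdistxx x : rdist x x = 0.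
Proof. by case: dm => _ /(_ x x) [_ h] _ _; rewrite /rdist h. Qed.

Lemma rdistC x y : rdist x y = rdist y x.
Proof. by case: dm => _ _ h _; rewrite /rdist h. Qed.

Lemma rdist_triangle y x z : rdist x z <= rdist x y + rdist y z.
Proof. by case: dm => _ _ _ /(_ x y z); rewrite !rdistE -EFinD lee_fin. Qed.

Lemma rdist_ge0 x y : 0 <= rdist x y.
Proof.
have := rdist_triangle y x x; rewrite rdistxx (rdistC y x) => h.
by rewrite -(pmulr_rge0 _ (ltr0n _ 2)) mulr_natl mulr2n.
Qed.

Lemma dballE x r : dball d x r = [set y | rdist x y < r].
Proof. by apply/funext => y; rewrite /dball /= rdistE lte_fin. Qed.

Lemma dopen_ball x r : dopen d (dball d x r).
Proof.
move=> y; rewrite dballE /= => xy; exists (r - rdist x y); rewrite subr_gt0.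
split=> // z; rewrite !dballE /= => yz.
by have := rdist_triangle y x z; lra.
Qed.

Lemma diam_ubound (C : set T) x y : C x -> C y -> (d x y <= diam d C)%E.
Proof. by move=> Cx Cy; apply: ereal_sup_ubound; exists (x, y). Qed.

Lemma diam_le (C : set T) (a : R) :
  (forall x y, C x -> C y -> rdist x y <= a) -> (diam d C <= a%:E)%E.
Proof.
move=> h; apply: ge_ereal_sup => _ [[x y] [/= Cx Cy] <-].
by rewrite rdistE lee_fin h.
Qed.

Lemma diam_fin_num (C : set T) (a : R) : C !=set0 -> (diam d C <= a%:E)%E ->
  [/\ diam d C = (fine (diam d C))%:E, 0 <= fine (diam d C), fine (diam d C) <= a &
     forall x y, C x -> C y -> rdist x y <= fine (diam d C)].
Proof.
move=> [x Cx] Ca.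
have C0 : (0 <= diam d C)%E.
  by have := diam_ubound Cx Cx; rewrite rdistE rdistxx.
have Cf : diam d C \is a fin_num by rewrite ge0_fin_numE// (le_lt_trans Ca)// ltry.
split; rewrite ?fineK//.
- exact: fine_ge0.
- by rewrite -lee_fin fineK.
- by move=> y z Cy Cz; rewrite -lee_fin -rdistE fineK// diam_ubound.
Qed.

End metric_facts.

Section metric_outer_measure.
Local Open Scope ereal_scope.
Context (R : realType) (T : Type) (d : T -> T -> \bar R) (dm : is_metric d).
Variable mu : {outer_measure set T -> \bar R}.
Hypothesis sep : forall (A B : set T) (e : R), (0 < e)%R ->
  (forall x y, A x -> B y -> (e <= rdist d x y)%R) ->
  mu A + mu B <= mu (A `|` B).

Lemma dopen_caratheodory U : dopen d U -> mu.-caratheodory U.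
Proof.
move=> oU; apply: le_caratheodory_measurable => X.
have [Xoo|] := eqVneq (mu X) +oo; first by rewrite Xoo leey.
rewrite -ltey => Xfin.
pose Xn n := [set x | X x /\ dball d x n.+1%:R^-1 `<=` U].
have XnX n : Xn n `<=` X by move=> x [].
have XnU n : Xn n `<=` U.
  by move=> x [_]; apply; rewrite dballE//= rdistxx//.
have Xnsub m n : (m <= n)%N -> Xn m `<=` Xn n.
  move=> mn x [Xx h]; split=> // y; rewrite dballE//= => yx; apply: h.
  rewrite dballE//=; apply: (lt_le_trans yx).
  by rewrite lef_pV2 ?posrE// ler_nat.
have sepn n (B : set T) : B `<=` X `\` Xn n.+1 -> mu (Xn n) + mu B <= mu (Xn n `|` B).
  move=> BX; apply: (@sep _ _ (n.+1%:R^-1 - n.+2%:R^-1)%R).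
    by rewrite subr_gt0 ltf_pV2 ?posrE// ltr_nat.
  move=> x y [_ xU] /BX[Xy] /not_andP[//|].
  move=> /existsNP[z /not_implyP[]]; rewrite dballE//= => yz Uz.
  have : ~ (rdist d x z < n.+1%:R^-1)%R.
    by move=> xz; apply: Uz; apply: xU; rewrite dballE.
  move/negP; rewrite -leNgt => xz.
  rewrite lerBlDr (le_trans xz)// (le_trans (rdist_triangle dm y x z))//.
  by rewrite lerD2l ltW.
pose D n := Xn n.+1 `\` Xn n.
have Xfin' A : A `<=` X -> mu A \is a fin_num.
  move=> AX; rewrite ge0_fin_numE ?outer_measure_ge0//.
  by apply: le_lt_trans Xfin; exact: le_outer_measure.
(* Xn m and the shell D m.+1 are separated, hence mu (D m.+1) + mu (Xn m) <= mu (Xn m.+2),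
   which telescopes. *)
have sumD m : \sum_(0 <= k < m) mu (D k.+1) + (mu (Xn 0%N) + mu (Xn 1%N))
    <= mu (Xn m) + mu (Xn m.+1).
  elim: m => [|m IH]; first by rewrite big_geq// add0e.
  rewrite big_nat_recr//= addeAC.
  apply: (le_trans (leeD2r _ IH)).
  rewrite addeAC [leRHS]addeC; apply: leeD2r.
  apply: (le_trans (sepn m _ _)); first by move=> x [[? ?] ?].
  by apply: le_outer_measure => x [/Xnsub|[]//]; apply; rewrite ltnW.
have D0 k : 0 <= mu (D k) by exact: outer_measure_ge0.
have sumDfin : \sum_(0 <= k <oo) mu (D k.+1) < +oo.
  apply: (@le_lt_trans _ _ (mu X + mu X)); last first.
    by rewrite -ge0_fin_numE ?adde_ge0 ?outer_measure_ge0// fin_numD Xfin'.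
  apply: lime_le; first by apply: is_cvg_nneseries => *.
  apply: nearW => m; apply: (@le_trans _ _ (mu (Xn m) + mu (Xn m.+1))).
    apply: le_trans (sumD m); rewrite leeDl//.
    by rewrite adde_ge0 ?outer_measure_ge0.
  by rewrite leeD// le_outer_measure.
have tail n : mu (X `&` U) <= mu (Xn n.+1) + \sum_(n <= k <oo) mu (D k.+1).
  apply: (@le_trans _ _ (mu (Xn n.+1 `|` \bigcup_(k in ~` `I_n) D k.+1))).
    apply: le_outer_measure => x [Xx Ux].
    have [r [r0 xr]] := oU _ Ux.
    have [m xm] : exists m, Xn m x.
      exists (Num.truncn r^-1); split=> // y; rewrite dballE//= => xy.
      apply: xr; rewrite dballE//=; apply: (lt_le_trans xy).
      rewrite -[leRHS]invrK lef_pV2 ?posrE ?invr_gt0// ltW//.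
      by rewrite truncnS_gt.
    have [k xk mk] : {k | Xn k x & forall j, (j < k)%N -> ~ Xn j x}.
      have h : exists m, `[< Xn m x >] by exists m; apply/asboolP.
      exists (ex_minn h); first by case: ex_minnP => k /asboolP.
      by case: ex_minnP => k _ kmin j jk /asboolP/kmin; rewrite leqNgt jk.
    have [kn|nk] := leqP k n.+1; first by left; exact: (Xnsub k).
    case: k nk xk mk => [//|[//|k]] nk xk mk.
    right; exists k; first by apply/negP; rewrite -leqNgt.
    by split => //; exact: mk.
  apply: (le_trans (outer_measureU2 _ _ _)); apply: leeD2l.
  exact: outer_measure_sigma_subadditive_tail.
have step n : mu (X `&` U) + mu (X `&` ~` U) <=
    mu X + \sum_(n <= k <oo) mu (D k.+1).
  apply: (le_trans (leeD2r _ (tail n))); rewrite addeAC; apply: leeD2r.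
  apply: (le_trans (sepn _ _ _)).
    by move=> x [Xx Ux]; split => // /XnU.
  by apply: le_outer_measure => x [/XnX|[]].
have cv : (fun n => mu X + \sum_(n <= k <oo) mu (D k.+1)) @ \oo --> mu X + 0.
  apply: cvgeD; [|exact: cvg_cst|exact: nneseries_tail_cvg].
  by rewrite fin_num_adde_defl// Xfin'.
rewrite -[leRHS]adde0 -(cvg_lim _ cv)//; apply: lime_ge.
  by apply/cvg_ex; exists (mu X + 0).
exact: nearW.
Qed.

Lemma dborel_caratheodory U : dborel d U -> mu.-caratheodory U.
Proof.
apply: smallest_sub; last exact: dopen_caratheodory.
split; first exact: caratheodory_measurable_set0.
- by move=> A mA; rewrite setTD; exact: caratheodory_measurable_setC.
- exact: caratheodory_measurable_bigcup.
Qed.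

End metric_outer_measure.

(** * Spherical Hausdorff measures *)

Section dborel_facts.
Context (R : realType) (T : Type) (d : T -> T -> \bar R).

Lemma dborel_open U : dopen d U -> dborel d U.
Proof. exact: sub_sigma_algebra. Qed.

Lemma dborelC U : dborel d U -> dborel d (~` U).
Proof. by move=> bU; rewrite -setTD; exact: sigma_algebraCD. Qed.

Lemma dborel_bigcup (U : nat -> set T) :
  (forall n, dborel d (U n)) -> dborel d (\bigcup_n U n).
Proof. exact: sigma_algebra_bigcup. Qed.

Lemma dborel_bigcap (U : nat -> set T) :
  (forall n, dborel d (U n)) -> dborel d (\bigcap_n U n).
Proof.
move=> bU; rewrite -[X in dborel d X]setCK setC_bigcap.
by apply: dborelC; apply: dborel_bigcup => n; apply: dborelC; exact: bU.
Qed.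

Lemma dborel_setT : dborel d setT.
Proof. by rewrite -setC0; apply: dborelC; exact: sigma_algebra0. Qed.

Lemma dborelI U V : dborel d U -> dborel d V -> dborel d (U `&` V).
Proof.
move=> bU bV; rewrite -bigcap2E; apply: dborel_bigcap => -[|[|n]] //=.
exact: dborel_setT.
Qed.

Lemma dopen_bigcup (I : Type) (P : set I) (U : I -> set T) :
  (forall i, P i -> dopen d (U i)) -> dopen d (\bigcup_(i in P) U i).
Proof.
move=> oU x [i Pi /(oU i Pi)[r [r0 rU]]]; exists r; split=> // y /rU Uy.
by exists i.
Qed.

End dborel_facts.

Section sph_haus_facts.
Local Open Scope ereal_scope.
Context (R : realType) (T : Type) (d : T -> T -> \bar R) (dm : is_metric d).
Variable s : R.

Lemma sph_family_sub (a b : R) : (a <= b)%R -> sph_family d a `<=` sph_family d b.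
Proof.
move=> ab C [->|[Cx Ca]]; [by left|right; split => //].
by apply: (le_trans Ca); rewrite lee_fin.
Qed.

Lemma cover_ext_family_le (G H : set (set T)) (c : set T -> \bar R) A :
  G `<=` H -> cover_ext H c A <= cover_ext G c A.
Proof.
move=> GH; apply: le_ereal_inf => _ [F [GF AF] <-]; exists F => //.
by split=> // k; exact: GH.
Qed.

Lemma cover_ext_le_sph_haus (a : R) A : (0 < a)%R ->
  cover_ext (sph_family d a) (hcost d s) A <= sph_haus d s A.
Proof. by move=> a0; apply: ereal_sup_ubound; exists a. Qed.

Lemma sph_haus_sep (A B : set T) (e : R) : (0 < e)%R ->
  (forall x y, A x -> B y -> (e <= rdist d x y)%R) ->
  sph_haus d s A + sph_haus d s B <= sph_haus d s (A `|` B).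
Proof.
move=> e0 AB.
have [->|] := eqVneq (sph_haus d s (A `|` B)) +oo; first by rewrite leey.
rewrite -ltey => ABfin.
have c0 C : 0 <= hcost d s C by exact: hcost_ge0.
have Afin : sph_haus d s A \is a fin_num.
  rewrite ge0_fin_numE ?outer_measure_ge0//; apply: le_lt_trans ABfin.
  by apply: le_outer_measure; exact: subsetUl.
have key (a b : R) : (0 < a)%R -> (0 < b)%R ->
    cover_ext (sph_family d a) (hcost d s) A +
    cover_ext (sph_family d b) (hcost d s) B <= sph_haus d s (A `|` B).
  move=> a0 b0; pose m := Num.min (Num.min a b) (e / 2)%R.
  have m0 : (0 < m)%R by rewrite !lt_min a0 b0 divr_gt0.
  apply: le_trans (cover_ext_le_sph_haus _ m0).
  apply: le_ereal_inf_tmp => _ [F [GF ABF] <-].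
  pose FA k := if pselect (F k `&` A !=set0) then F k else set0.
  pose FB k := if pselect (F k `&` B !=set0) then F k else set0.
  apply: (@le_trans _ _ (\sum_(k <oo) hcost d s (FA k) + \sum_(k <oo) hcost d s (FB k))).
    apply: leeD; apply: ereal_inf_lbound => /=.
      exists FA; [split=> [k|x Ax]|by []].
        rewrite /FA; case: pselect => [?|?]; last by left.
        by apply: sph_family_sub (GF k); rewrite !ge_min lexx.
      have [k _ Fkx] := ABF x (or_introl Ax); exists k => //.
      by rewrite /FA; case: pselect => // -[]; exists x.
    exists FB; [split=> [k|x Bx]|by []].
      rewrite /FB; case: pselect => [?|?]; last by left.
      by apply: sph_family_sub (GF k); rewrite !ge_min lexx orbT.
    have [k _ Fkx] := ABF x (or_intror Bx); exists k => //.
    by rewrite /FB; case: pselect => // -[]; exists x.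
  rewrite -nneseriesD//; apply: lee_nneseries => [i _ _|k _]; first exact: adde_ge0.
  rewrite /FA /FB; case: pselect => [[x [Fx Ax]]|?]; case: pselect => [[y [Fy By]]|?];
    rewrite ?hcost0 ?adde0 ?add0e//.
  exfalso; case: (GF k) => [F0|[_ Fm]]; first by rewrite F0 in Fx.
  have [_ _ Fm' /(_ _ _ Fx Fy)] := diam_fin_num dm (ex_intro _ x Fx) Fm.
  have := AB _ _ Ax By; have : (m <= e / 2)%R by rewrite !ge_min lexx orbT.
  lra.
rewrite -leeBrDl//; apply: ge_ereal_sup => _ [b /= b0 <-].
rewrite leeBrDl//.
have Bfin : cover_ext (sph_family d b) (hcost d s) B \is a fin_num.
  rewrite ge0_fin_numE ?cover_ext_ge0//; apply: le_lt_trans ABfin.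
  apply: le_trans (cover_ext_le_sph_haus _ b0) _.
  by apply: le_outer_measure; exact: subsetUr.
rewrite -leeBrDr//; apply: ge_ereal_sup => _ [a /= a0 <-].
by rewrite leeBrDr// key.
Qed.

Lemma sph_haus_dborel U : dborel d U -> (sph_haus d s).-caratheodory U.
Proof.
apply: (@dborel_caratheodory _ _ _ dm (sph_haus d s)) => A B e.
exact: sph_haus_sep.
Qed.

Lemma sph_family_open a C : sph_family d a C -> dopen d C.
Proof. by move=> [->|[[x [r [_ ->]]] _]] //; exact: dopen_ball. Qed.

Lemma sph_haus_regular A : exists B,
  [/\ dborel d B, A `<=` B & sph_haus d s A = sph_haus d s B].
Proof.
have [Aoo|] := eqVneq (sph_haus d s A) +oo.
  exists setT; split => //; first exact: dborel_setT.
  by apply/eqP; rewrite eq_le (le_outer_measure (sph_haus d s)) //= Aoo leey.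
rewrite -ltey => Afin.
have Afin' : sph_haus d s A \is a fin_num by rewrite ge0_fin_numE ?outer_measure_ge0.
have c0 C : 0 <= hcost d s C by exact: hcost_ge0.
pose P n F := gcover (sph_family d n.+1%:R^-1) A F /\
  \sum_(k <oo) hcost d s (F k) <= sph_haus d s A + (n.+1%:R^-1)%:E.
have [F PF] : {F : nat -> nat -> set T & forall n, P n (F n)}.
  apply: choice => n.
  have nA := @cover_ext_le_sph_haus n.+1%:R^-1 A (ltac:(by [])).
  have nAfin : cover_ext (sph_family d n.+1%:R^-1) (hcost d s) A \is a fin_num.
    by rewrite ge0_fin_numE ?cover_ext_ge0// (le_lt_trans nA).
  have n0 : (0 < n.+1%:R^-1 :> R)%R by [].
  have [_ [F FA <-] Fs] := lb_ereal_inf_adherent n0 nAfin.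
  by exists F; split=> //; apply: (le_trans (ltW Fs)); exact: leeD2r.
pose B := \bigcap_n \bigcup_k F n k.
have AB : A `<=` B by move=> x Ax n _; exact: (PF n).1.2.
exists B; split => //.
  apply: dborel_bigcap => n; apply: dborel_open; apply: dopen_bigcup => k _.
  exact: sph_family_open ((PF n).1.1 k).
apply/eqP; rewrite eq_le (le_outer_measure (sph_haus d s)) //=.
apply: ge_ereal_sup => _ [a /= a0 <-]; apply/lee_addgt0Pr => e e0.
pose n := Num.truncn (Num.min a e)^-1.
have m0 : (0 < Num.min a e)%R by rewrite lt_min a0 e0.
have nm : (n.+1%:R^-1 <= Num.min a e)%R.
  rewrite -[leRHS]invrK lef_pV2 ?posrE ?invr_gt0// ltW//.
  by rewrite truncnS_gt.
apply: (@le_trans _ _ (\sum_(k <oo) hcost d s (F n k))).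
  apply: ereal_inf_lbound; exists (F n) => //; split=> [k|x /(_ n)]; last exact.
  apply: sph_family_sub ((PF n).1.1 k).
  by apply: (le_trans nm); rewrite ge_min lexx.
apply: (le_trans (PF n).2); apply: leeD2l.
by rewrite lee_fin (le_trans nm)// ge_min lexx orbT.
Qed.

Lemma hcost_ball_le y (r : R) : (0 <= s)%R ->
  hcost d s (dball d y r) <= ((2 * r) `^ s)%:E /\ diam d (dball d y r) <= (2 * r)%:E.
Proof.
move=> s0.
have D : diam d (dball d y r) <= (2 * r)%:E.
  apply: diam_le => // x z; rewrite dballE//= => yx yz.
  by have := rdist_triangle dm y x z; rewrite (rdistC dm x y); lra.
split=> //; rewrite /hcost; case: ifPn => [_|/set0P ne].
  by rewrite lee_fin powR_ge0.
have [_ D0 Dr _] := diam_fin_num dm ne D.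
by rewrite lee_fin ge0_ler_powR// nnegrE (le_trans D0).
Qed.

Lemma sph_haus_expand (A : set T) (f : T -> T) (L : R) : (0 <= s)%R -> (0 < L)%R ->
  (forall x (r : R), (0 < r)%R -> exists y, dball d x r y /\ (0 < rdist d x y)%R) ->
  (forall x y, A x -> A y -> (rdist d x y <= L * rdist d (f x) (f y))%R) ->
  sph_haus d s A <= ((4 * L) `^ s)%:E * sph_haus d s (f @` A).
Proof.
move=> s0 L0 noiso Lf.
have c0 C : 0 <= hcost d s C by exact: hcost_ge0.
have L4 : (0 < (4 * L) `^ s)%R by rewrite powR_gt0// mulr_gt0.
apply: ge_ereal_sup => _ [a /= a0 <-].
have a'0 : (0 < a / (4 * L))%R by rewrite divr_gt0// mulr_gt0.
apply: (@le_trans _ _ (((4 * L) `^ s)%:E *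
    cover_ext (sph_family d (a / (4 * L))) (hcost d s) (f @` A))); last first.
  by apply: lee_wpmul2l; [rewrite lee_fin ltW|exact: cover_ext_le_sph_haus].
rewrite -lee_pdivrMl//; apply: le_ereal_inf_tmp => _ [F [GF AF] <-].
rewrite lee_pdivrMl// -nneseriesZl//.
pose P k (C : set T) := [/\ sph_family d a C,
  (forall x, A x -> F k (f x) -> C x) &
  hcost d s C <= ((4 * L) `^ s)%:E * hcost d s (F k)].
have [H PH] : {H : nat -> set T & forall k, P k (H k)}.
  apply: choice => k.
  have [[y [Ay Fy]]|no] := pselect (exists y, A y /\ F k (f y)); last first.
    exists set0; split; [by left|by move=> x Ax Fx; apply: no; exists x|].
    by rewrite hcost0 mule_ge0// lee_fin ltW.
  case: (GF k) => [F0|[[x [r [r0 Fxr]]] Fd]]; first by rewrite F0 in Fy.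
  have [Dfin D0 Da Dub] := diam_fin_num dm (ex_intro _ _ Fy) Fd.
  set D := fine (diam d (F k)) in D0 Da Dub Dfin.
  have {D0}Dgt0 : (0 < D)%R.
    have [z [xz xz0]] := noiso x r r0.
    apply: (lt_le_trans xz0); apply: Dub; rewrite Fxr// dballE//= rdistxx//.
  have r2 : (2 * (2 * L * D) = 4 * L * D)%R by ring.
  have [h1 h2] := hcost_ball_le y (2 * L * D) s0.
  rewrite r2 in h1 h2.
  exists (dball d y (2 * L * D)); split.
  - right; split; first by exists y, (2 * L * D)%R; rewrite !mulr_gt0.
    apply: (le_trans h2); rewrite lee_fin.
    by rewrite mulrC -ler_pdivlMr ?mulr_gt0.
  - move=> z Az Fz; rewrite dballE//=; apply: (le_lt_trans (Lf _ _ Ay Az)).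
    rewrite -mulrA mulrCA ltr_pM2l//; have := Dub _ _ Fy Fz; lra.
  - apply: (le_trans h1); rewrite powRM; [|by rewrite mulr_ge0// ltW|exact: ltW].
    rewrite EFinM /hcost; case: ifPn => [/eqP F0|_]; first by rewrite F0 in Fy.
    by [].

apply: (@le_trans _ _ (\sum_(k <oo) hcost d s (H k))).
  apply: ereal_inf_lbound; exists H => //; split=> [k|x Ax]; first by case: (PH k).
  have [k _ Fk] := AF (f x) (ex_intro2 _ _ x Ax erefl).
  by exists k => //; case: (PH k) => _ h _; exact: h.
by apply: lee_nneseries => // k _; case: (PH k).
Qed.

End sph_haus_facts.

(** * The product outer measure *)

Section prod_outer_measure.
Local Open Scope ereal_scope.
Context (R : realType) (T : pointedType).
Variable mu : {outer_measure set T -> \bar R}.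

Definition car_rectangles : set (set (T * T)) := [set C | exists A B,
  [/\ mu.-caratheodory A, mu.-caratheodory B & C = A `*` B]].

Definition rectangle_cost (C : set (T * T)) : \bar R :=
  mu (fst @` C) * mu (snd @` C).

Lemma rectangle_costE A B : rectangle_cost (A `*` B) = mu A * mu B.
Proof.
rewrite /rectangle_cost.
have [->|/set0P[a Aa]] := eqVneq A set0.
  by rewrite set0X !image_set0 outer_measure0 !mul0e.
have [->|/set0P[b Bb]] := eqVneq B set0.
  by rewrite setX0 !image_set0 outer_measure0 !mule0.
congr (mu _ * mu _); apply/seteqP; split => x.
- by move=> [[y z] [/= Ay Bz] <-].
- by move=> Ax; exists (x, b).
- by move=> [[y z] [/= Ay Bz] <-].
- by move=> Bx; exists (a, x).
Qed.

Lemma rectangle_cost_ge0 C : 0 <= rectangle_cost C.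
Proof. by rewrite mule_ge0// outer_measure_ge0. Qed.

Lemma prod_outerE : prod_outer mu = cover_ext car_rectangles rectangle_cost.
Proof.
apply/funext => E; congr ereal_inf; apply/seteqP; split => e.
  move=> [A [B [AB EAB ->]]]; exists (fun k => A k `*` B k).
    by split => // k; exists (A k), (B k); case: (AB k).
  by apply: eq_eseriesr => k _; rewrite rectangle_costE.
move=> [F [GF EF] <-].
have /choice[A PA] : forall k, exists A, exists B,
  [/\ mu.-caratheodory A, mu.-caratheodory B & F k = A `*` B] by exact: GF.
have /choice[B PB] := PA.
exists A, B; split.
- by move=> k; have [] := PB k.
- by move=> x /EF[k _ Fk]; exists k => //; have [_ _ <-] := PB k.
- by apply: eq_eseriesr => k _; have [_ _ ->] := PB k; rewrite rectangle_costE.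
Qed.

Let rect0 : car_rectangles set0.
Proof.
by exists set0, set0; split; rewrite ?setX0//; exact: caratheodory_measurable_set0.
Qed.

Let cost0 : rectangle_cost set0 = 0.
Proof. by rewrite /rectangle_cost !image_set0 outer_measure0 mule0. Qed.

Let prod_outer0 : prod_outer mu set0 = 0.
Proof. by rewrite prod_outerE cover_ext0//; exact: rectangle_cost_ge0. Qed.

Let prod_outer_ge0 A : 0 <= prod_outer mu A.
Proof. by rewrite prod_outerE cover_ext_ge0//; exact: rectangle_cost_ge0. Qed.

Let le_prod_outer : {homo prod_outer mu : A B / A `<=` B >-> A <= B}.
Proof. by rewrite prod_outerE; exact: le_cover_ext. Qed.

Let prod_outer_subadd : sigma_subadditive (prod_outer mu).
Proof.
by rewrite prod_outerE; apply: cover_ext_sigma_subadditive; exact: rectangle_cost_ge0.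
Qed.

HB.instance Definition _ := isOuterMeasure.Build R (T * T)%type (prod_outer mu)
  prod_outer0 prod_outer_ge0 le_prod_outer prod_outer_subadd.

Lemma prod_outer_rectangle (A0 B0 : set T) :
  mu.-caratheodory A0 -> mu.-caratheodory B0 ->
  (prod_outer mu).-caratheodory (A0 `*` B0).
Proof.
move=> mA0 mB0; apply: le_caratheodory_measurable => X.
have mu0 (A : set T) : 0 <= mu A by exact: outer_measure_ge0.
apply: le_ereal_inf_tmp => _ [A [B [AB XAB ->]]].
have cov (C D : nat -> set T) Y : (forall k, mu.-caratheodory (C k)) ->
    (forall k, mu.-caratheodory (D k)) -> Y `<=` \bigcup_k (C k `*` D k) ->
    prod_outer mu Y <= \sum_(k <oo) mu (C k) * mu (D k).
  by move=> mC mD YCD; apply: ereal_inf_lbound; exists C, D; split.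
have mI := @caratheodory_measurable_setI _ _ mu.
have mC := @caratheodory_measurable_setC _ _ mu.
have AB0 k : mu (A k) * mu (B k) = mu (A k `&` A0) * mu (B k `&` B0) +
    (mu (A k `&` A0) * mu (B k `&` ~` B0) + mu (A k `&` ~` A0) * mu (B k)).
  rewrite {1}(mA0 (A k)) ge0_muleDl// {1}(mB0 (B k)) ge0_muleDr//.
  by rewrite addeA.
rewrite (eq_eseriesr (fun k _ => AB0 k)) nneseriesD; last 2 first.
- by move=> *; rewrite mule_ge0.
- by move=> *; rewrite adde_ge0// mule_ge0.
apply: leeD.
  apply: cov; [by move=> k; apply: mI => //; case: (AB k)..|].
  move=> [x y] [/XAB[k _ [/= Ax By]] [/= A0x B0y]]; by exists k.
rewrite nneseriesD; [|by move=> *; rewrite mule_ge0..].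
pose X1 := \bigcup_k ((A k `&` A0) `*` (B k `&` ~` B0)).
pose X2 := \bigcup_k ((A k `&` ~` A0) `*` B k).
apply: (@le_trans _ _ (prod_outer mu (X1 `|` X2))).
  apply: (le_outer_measure (prod_outer mu)) => -[x y] [/XAB[k _ [/= Ax By]]].
  move=> /not_andP /= [nA|nB]; first by right; exists k.
  have [A0x|nA] := pselect (A0 x); first by left; exists k.
  by right; exists k.
apply: (le_trans (outer_measureU2 (prod_outer mu) _ _)); apply: leeD; apply: cov => //.
- by move=> k; apply: mI => //; case: (AB k).
- by move=> k; apply: mI; [case: (AB k)|exact: mC].
- by move=> k; apply: mI; [case: (AB k)|exact: mC].
- by move=> k; case: (AB k).
Qed.

Context (d : T -> T -> \bar R) (dm : is_metric d).
Hypothesis sepd : separable d.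
Hypothesis borel_mu : forall U, dborel d U -> mu.-caratheodory U.

Lemma separable_seq : exists e : nat -> T,
  forall x (r : R), (0 < r)%R -> exists i, (rdist d x (e i) < r)%R.
Proof.
case: sepd => D [/countable_injP[f finj] dense].
have /choice[e he] : forall i, exists x : T, (exists y, D y /\ f y = i) -> D x /\ f x = i.
  move=> i; have [[y [Dy fy]]|no] := pselect (exists y, D y /\ f y = i).
    by exists y.
  by exists point => /no.
exists e => x r r0; have [y [Dy xy]] := dense x r r0.
exists (f y); have [De fe] := he (f y) (ex_intro _ y (conj Dy erefl)).
by rewrite (finj _ _ _ _ fe) ?inE// -lte_fin -rdistE.
Qed.

Lemma prod_outer_open (O : set (T * T)) :
  (forall x y, O (x, y) -> exists r : R, (0 < r)%R /\ dball d x r `*` dball d y r `<=` O) ->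
  (prod_outer mu).-caratheodory O.
Proof.
move=> oO; have [e he] := separable_seq.
pose B n i j := dball d (e i) n.+1%:R^-1 `*` dball d (e j) n.+1%:R^-1.
pose C n i j := if pselect (B n i j `<=` O) then B n i j else set0.
have -> : O = \bigcup_n \bigcup_i \bigcup_j C n i j.
  apply/seteqP; split => [[x y] Oxy|z [n _ [i _ [j _]]]]; last first.
    by rewrite /C; case: pselect => // BO /BO.
  have [r [r0 rO]] := oO _ _ Oxy.
  pose n := Num.truncn (r / 2)^-1.
  have nm : (n.+1%:R^-1 < r / 2)%R.
    by rewrite -[ltRHS]invrK ltf_pV2 ?posrE ?invr_gt0 ?divr_gt0// truncnS_gt.
  have n0 : (0 < n.+1%:R^-1 :> R)%R by [].
  have [i xi] := he x _ n0; have [j yj] := he y _ n0.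
  exists n => //; exists i => //; exists j => //; rewrite /C.
  case: pselect => [?|[]].
    by split; rewrite /= dballE//= rdistC.
  move=> [u v] [/=]; rewrite !dballE//= => iu jv; apply: rO.
  split; rewrite /= dballE//=.
    by rewrite (le_lt_trans (rdist_triangle dm (e i) x u))// (splitr r) ltrD// (lt_trans _ nm).
  by rewrite (le_lt_trans (rdist_triangle dm (e j) y v))// (splitr r) ltrD// (lt_trans _ nm).
do 3 (apply: caratheodory_measurable_bigcup => ?).
rewrite /C; case: pselect => [?|?]; last exact: caratheodory_measurable_set0.
by apply: prod_outer_rectangle; apply: borel_mu; apply: dborel_open; exact: dopen_ball.
Qed.

End prod_outer_measure.

(** * Geometry of the plane times the circle *)

Section trig_bounds.
Context (R : realType).
Implicit Types x y : R.

Lemma sin_mean_value x : 0 <= x -> exists2 c, 0 <= c <= x & sin x = cos c * x.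
Proof.
move=> x0; have [c] := @MVT_segment R sin cos 0 x x0 (fun y _ => is_derive_sin y)
  (continuous_subspaceT (@continuous_sin R)).
by rewrite in_itv/= sin0 !subr0 => ? ?; exists c.
Qed.

Lemma normr_sin x : `|sin x| = `|sin `|x| |.
Proof. by case: (ger0P x) => // _; rewrite sinN normrN. Qed.

Lemma sin_abs_le x : `|sin x| <= `|x|.
Proof.
rewrite normr_sin; have [c _ ->] := sin_mean_value (normr_ge0 x).
by rewrite normrM normr_id ler_piMl// cos_max.
Qed.

Lemma one_sub_cos x : 1 - cos x = 2 * sin (x / 2) ^+ 2.
Proof.
have -> : cos x = cos ((x / 2) *+ 2) by congr cos; rewrite mulr2n -splitr.
by rewrite cos_mulr2n sin2cos2; ring.
Qed.

Lemma one_sub_cos_le x : 1 - cos x <= x ^+ 2 / 2.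
Proof.
rewrite one_sub_cos.
have : sin (x / 2) ^+ 2 <= (x / 2) ^+ 2.
  by rewrite -real_normK ?num_real// -(real_normK (num_real (x / 2))) lerXn2r ?nnegrE ?sin_abs_le.
lra.
Qed.

Lemma sin_abs_ge x : `|x| <= 1 -> `|x| / 2 <= `|sin x|.
Proof.
rewrite normr_sin; have := normr_ge0 x; move: `|x| => {x} x x0 x1.
have [c /andP[c0 cx] ->] := sin_mean_value x0.
have c2 : c ^+ 2 <= 1 by rewrite expr_le1// (le_trans cx).
have := one_sub_cos_le c => h.
rewrite normrM (ger0_norm x0) [leLHS]mulrC ler_wpM2r// ger0_norm; lra.
Qed.

Lemma one_sub_cos_ge x : `|x| <= 1 -> x ^+ 2 / 8 <= 1 - cos x.
Proof.
move=> x1; rewrite one_sub_cos.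
have : (`|x / 2| / 2) ^+ 2 <= `|sin (x / 2)| ^+ 2.
  rewrite lerXn2r ?nnegrE//; apply: sin_abs_ge.
  by rewrite normrM (@ger0_norm _ 2^-1)//; lra.
by rewrite expr_div_n !real_normK ?num_real// expr_div_n; lra.
Qed.

End trig_bounds.

Section RRS1_geometry.
Context (R : realType).
Local Notation T := (RRS1 R).
Implicit Types p q : T.

Definition cdist p q : R :=
  `|px p - px q| + `|py p - py q| + (`|cth p - cth q| + `|sth p - sth q|).

Lemma cth2sth2 p : cth p ^+ 2 + sth p ^+ 2 = 1.
Proof. by rewrite /cth /sth; case: p => ? [[a b] /= /eqP]. Qed.

Lemma cth_le1 p : `|cth p| <= 1.
Proof.
rewrite -(@expr_le1 _ 2)// real_normK ?num_real// -(cth2sth2 p) lerDl sqr_ge0//.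
Qed.

Lemma sth_le1 p : `|sth p| <= 1.
Proof.
rewrite -(@expr_le1 _ 2)// real_normK ?num_real// -(cth2sth2 p) lerDr sqr_ge0//.
Qed.

Lemma RRS1_eq p q : px p = px q -> py p = py q -> cth p = cth q -> sth p = sth q ->
  p = q.
Proof.
case: p => [[x y] [[c s] h]]; case: q => [[x' y'] [[c' s'] h']] /=.
rewrite /px /py /cth /sth /= => -> -> Ec Es; congr pair.
by apply/val_inj => /=; rewrite Ec Es.
Qed.

Lemma cdist_ge0 p q : 0 <= cdist p q.
Proof. by rewrite !addr_ge0. Qed.

Lemma cdistxx p : cdist p p = 0.
Proof. by rewrite /cdist !subrr normr0 !addr0. Qed.

Lemma cdistC p q : cdist p q = cdist q p.
Proof.
by rewrite /cdist (distrC (px p)) (distrC (py p)) (distrC (cth p)) (distrC (sth p)).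
Qed.

Lemma cdist_triangle q p r : cdist p r <= cdist p q + cdist q r.
Proof.
rewrite /cdist.
have := ler_distD (px q) (px p) (px r); have := ler_distD (py q) (py p) (py r).
have := ler_distD (cth q) (cth p) (cth r); have := ler_distD (sth q) (sth p) (sth r).
lra.
Qed.

Lemma cdist_eq0 p q : cdist p q = 0 -> p = q.
Proof.
rewrite /cdist => h; apply: RRS1_eq; apply/eqP; rewrite -subr_eq0 -normr_le0;
have := normr_ge0 (px p - px q); have := normr_ge0 (py p - py q);
have := normr_ge0 (cth p - cth q); have := normr_ge0 (sth p - sth q); lra.
Qed.

Lemma rotS1_proof (u : S1 R) (a : R) :
  ((sval u).1 * cos a - (sval u).2 * sin a) ^+ 2 +
  ((sval u).2 * cos a + (sval u).1 * sin a) ^+ 2 == 1.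
Proof.
case: u => -[c s] /= /eqP cs; apply/eqP.
transitivity ((c ^+ 2 + s ^+ 2) * (cos a ^+ 2 + sin a ^+ 2)); first by ring.
by rewrite cs cos2Dsin2 mul1r.
Qed.

Definition rotS1 (u : S1 R) (a : R) : S1 R :=
  exist _ ((sval u).1 * cos a - (sval u).2 * sin a,
           (sval u).2 * cos a + (sval u).1 * sin a) (rotS1_proof u a).

Definition chart p (a b c : R) : T := ((px p + a, py p + b), rotS1 p.2 c).

Lemma px_chart p a b c : px (chart p a b c) = px p + a. Proof. by []. Qed.
Lemma py_chart p a b c : py (chart p a b c) = py p + b. Proof. by []. Qed.
Lemma cth_chart p a b c : cth (chart p a b c) = cth p * cos c - sth p * sin c.
Proof. by []. Qed.
Lemma sth_chart p a b c : sth (chart p a b c) = sth p * cos c + cth p * sin c.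
Proof. by []. Qed.
Definition chartE := (px_chart, py_chart, cth_chart, sth_chart).

Definition cosd p q : R := cth p * cth q + sth p * sth q.
Definition sind p q : R := cth p * sth q - sth p * cth q.
Definition ang p q : R := asin (sind p q).

Lemma cosd2sind2 p q : cosd p q ^+ 2 + sind p q ^+ 2 = 1.
Proof.
transitivity ((cth p ^+ 2 + sth p ^+ 2) * (cth q ^+ 2 + sth q ^+ 2)).
  by rewrite /cosd /sind; ring.
by rewrite !cth2sth2 mul1r.
Qed.

Lemma chartD p a b c a' b' c' :
  chart (chart p a b c) a' b' c' = chart p (a + a') (b + b') (c + c').
Proof. by apply: RRS1_eq; rewrite !chartE ?addrA// ?cosD ?sinD; ring. Qed.

Lemma chart0 p : chart p 0 0 0 = p.
Proof. by apply: RRS1_eq; rewrite !chartE ?addr0 ?cos0 ?sin0; ring. Qed.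

Lemma cosd_chart p a b c : cosd p (chart p a b c) = cos c.
Proof.
rewrite /cosd !chartE.
transitivity ((cth p ^+ 2 + sth p ^+ 2) * cos c); first by ring.
by rewrite cth2sth2 mul1r.
Qed.

Lemma sind_chart p a b c : sind p (chart p a b c) = sin c.
Proof.
rewrite /sind !chartE.
transitivity ((cth p ^+ 2 + sth p ^+ 2) * sin c); first by ring.
by rewrite cth2sth2 mul1r.
Qed.

Lemma ang_chart p a b c : `|c| <= pi / 2 -> ang p (chart p a b c) = c.
Proof. by move=> cpi; rewrite /ang sind_chart sinK// in_itv/= -ler_norml. Qed.

Lemma sind_lt1 p q : 0 < cosd p q -> -1 < sind p q < 1.
Proof.
move=> c0; rewrite -ltr_norml -(@expr_lt1 _ 2)// real_normK ?num_real//.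
by rewrite -(cosd2sind2 p q) ltrDr exprn_gt0.
Qed.

Lemma sin_ang p q : 0 < cosd p q -> sin (ang p q) = sind p q.
Proof.
by move=> /sind_lt1/andP[s1 s2]; rewrite /ang asinK// in_itv/= !ltW.
Qed.

Lemma cos_ang p q : 0 < cosd p q -> cos (ang p q) = cosd p q.
Proof.
move=> c0; have /andP[s1 s2] := sind_lt1 c0; rewrite /ang cos_asin ?ltW//.
have -> : 1 - sind p q ^+ 2 = cosd p q ^+ 2 by rewrite -(cosd2sind2 p q); ring.
by rewrite sqrtr_sqr gtr0_norm.
Qed.

Lemma ang_ltpi2 p q : 0 < cosd p q -> `|ang p q| < pi / 2.
Proof.
move=> /sind_lt1/andP[s1 s2]; rewrite ltr_norml /ang.
by rewrite asin_gtNpi2 ?asin_ltpi2// ?s1 ?s2 ltW.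
Qed.

Lemma chart_ang p q : 0 < cosd p q ->
  chart p (px q - px p) (py q - py p) (ang p q) = q.
Proof.
move=> c0; apply: RRS1_eq; rewrite !chartE.
- by rewrite addrC subrK.
- by rewrite addrC subrK.
- rewrite cos_ang// sin_ang// /cosd /sind.
  transitivity ((cth p ^+ 2 + sth p ^+ 2) * cth q); first by ring.
  by rewrite cth2sth2 mul1r.
- rewrite cos_ang// sin_ang// /cosd /sind.
  transitivity ((cth p ^+ 2 + sth p ^+ 2) * sth q); first by ring.
  by rewrite cth2sth2 mul1r.
Qed.

Lemma chord_chart p a b c a' b' c' :
  (cth (chart p a b c) - cth (chart p a' b' c')) ^+ 2 +
  (sth (chart p a b c) - sth (chart p a' b' c')) ^+ 2 = (2 * sin ((c - c') / 2)) ^+ 2.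
Proof.
transitivity (2 * (1 - cos (c - c'))); last by rewrite one_sub_cos; ring.
rewrite cosB !chartE.
transitivity ((cth p ^+ 2 + sth p ^+ 2) *
  ((cos c ^+ 2 + sin c ^+ 2) + (cos c' ^+ 2 + sin c' ^+ 2)
   - 2 * (cos c * cos c' + sin c * sin c'))); first by ring.
by rewrite cth2sth2 !cos2Dsin2; ring.
Qed.

Lemma cdist_chart_le p a b c a' b' c' :
  cdist (chart p a b c) (chart p a' b' c') <= `|a - a'| + `|b - b'| + 2 * `|c - c'|.
Proof.
rewrite {1}/cdist.
have := chord_chart p a b c a' b' c'.
set u := cth _ - cth _; set v := sth _ - sth _ => uv.
have hs : (2 * sin ((c - c') / 2)) ^+ 2 <= (c - c') ^+ 2.
  rewrite -real_normK ?num_real// -[leRHS]real_normK ?num_real//.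
  rewrite lerXn2r ?nnegrE//.
  rewrite normrM ger0_norm//; have := sin_abs_le ((c - c') / 2).
  by rewrite normrM (@ger0_norm _ 2^-1)//; lra.
have hu : `|u| <= `|c - c'|.
  rewrite -(@ler_pXn2r _ 2) ?nnegrE// !real_normK ?num_real//.
  by have := sqr_ge0 v; lra.
have hv : `|v| <= `|c - c'|.
  rewrite -(@ler_pXn2r _ 2) ?nnegrE// !real_normK ?num_real//.
  by have := sqr_ge0 u; lra.
rewrite !chartE.
have -> : px p + a - (px p + a') = a - a' by ring.
have -> : py p + b - (py p + b') = b - b' by ring.
lra.
Qed.

Lemma cdist_chart_ge p a b c a' b' c' : `|c - c'| <= 2 ->
  `|a - a'| + `|b - b'| + `|c - c'| / 2 <= cdist (chart p a b c) (chart p a' b' c').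
Proof.
move=> c2; rewrite {1}/cdist.
have := chord_chart p a b c a' b' c'.
set u := cth _ - cth _; set v := sth _ - sth _ => uv.
have hc : `|c - c'| / 2 <= `|u| + `|v|.
  rewrite -(@ler_pXn2r _ 2) ?nnegrE ?divr_ge0 ?addr_ge0//.
  rewrite sqrrD !real_normK ?num_real//.
  have h : (`|c - c'| / 2) ^+ 2 <= (2 * sin ((c - c') / 2)) ^+ 2.
    rewrite -[leRHS]real_normK ?num_real// lerXn2r ?nnegrE ?divr_ge0//.
    rewrite normrM (@ger0_norm _ 2)//.
    have := @sin_abs_ge _ ((c - c') / 2).
    rewrite normrM (@ger0_norm _ 2^-1)// => /(_ ltac:(lra)); lra.
  have : 0 <= `|u| * `|v| by rewrite mulr_ge0.
  rewrite -mulr_natr; lra.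
rewrite !chartE.
have -> : px p + a - (px p + a') = a - a' by ring.
have -> : py p + b - (py p + b') = b - b' by ring.
lra.
Qed.

Lemma cdist_cosd p q : cdist p q <= 1 -> 0 < cosd p q.
Proof.
move=> pq1.
have h : (cth p - cth q) ^+ 2 + (sth p - sth q) ^+ 2 <= cdist p q.
  have h1 : (cth p - cth q) ^+ 2 <= `|cth p - cth q|.
    rewrite -real_normK ?num_real// expr2 ler_piMr//; move: pq1; rewrite /cdist.
    have := normr_ge0 (px p - px q); have := normr_ge0 (py p - py q).
    have := normr_ge0 (sth p - sth q); lra.
  have h2 : (sth p - sth q) ^+ 2 <= `|sth p - sth q|.
    rewrite -real_normK ?num_real// expr2 ler_piMr//; move: pq1; rewrite /cdist.
    have := normr_ge0 (px p - px q); have := normr_ge0 (py p - py q).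
    have := normr_ge0 (cth p - cth q); lra.
  rewrite /cdist; have := normr_ge0 (px p - px q); have := normr_ge0 (py p - py q).
  lra.
have : (cth p - cth q) ^+ 2 + (sth p - sth q) ^+ 2 = 2 - 2 * cosd p q.
  transitivity ((cth p ^+ 2 + sth p ^+ 2) + (cth q ^+ 2 + sth q ^+ 2) - 2 * cosd p q).
    by rewrite /cosd; ring.
  by rewrite !cth2sth2; ring.
lra.
Qed.

Lemma chart_le_cdist p q : 0 < cosd p q ->
  `|px q - px p| + `|py q - py p| + `|ang p q| / 2 <= cdist p q.
Proof.
move=> c0.
have := @cdist_chart_ge p (px q - px p) (py q - py p) (ang p q) 0 0 0.
rewrite !subr0 chart_ang// chart0 cdistC; apply; rewrite ltW// (lt_trans (ang_ltpi2 c0))//.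
exact: pihalf_lt2.
Qed.

Definition interp (t : R) p q : T :=
  if 0 < cosd p q then chart p (t * (px q - px p)) (t * (py q - py p)) (t * ang p q)
  else p.

Lemma interpE t p q : 0 < cosd p q -> interp t p q =
  chart p (t * (px q - px p)) (t * (py q - py p)) (t * ang p q).
Proof. by rewrite /interp => ->. Qed.

Lemma interp0 p q : interp 0 p q = p.
Proof. by rewrite /interp !mul0r chart0; case: ifP. Qed.

Lemma cosdC p q : cosd p q = cosd q p.
Proof. by rewrite /cosd; ring. Qed.

Lemma chartK p a b c : chart (chart p a b c) (- a) (- b) (- c) = p.
Proof. by rewrite chartD !subrr chart0. Qed.

Lemma angC p q : 0 < cosd p q -> ang q p = - ang p q.
Proof.
move=> c0; have := chartK p (px q - px p) (py q - py p) (ang p q).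
rewrite chart_ang// !opprB => E.
have := @ang_chart q (px p - px q) (py p - py q) (- ang p q).
by rewrite E normrN; apply; exact: ltW (ang_ltpi2 c0).
Qed.

Lemma interpC t p q : 0 < cosd p q -> interp t p q = interp (1 - t) q p.
Proof.
move=> c0; rewrite !interpE ?(cosdC q)// (angC c0).
have := chartD p (px q - px p) (py q - py p) (ang p q)
  ((1 - t) * (px p - px q)) ((1 - t) * (py p - py q)) ((1 - t) * - ang p q).
by rewrite chart_ang// => ->; congr chart; ring.
Qed.

Lemma pos_cosd_interp t p q : 0 <= t <= 1 -> 0 < cosd p q -> 0 < cosd p (interp t p q).
Proof.
move=> /andP[t0 t1] c0; rewrite interpE// cosd_chart.
apply: cos_gt0_pihalf; rewrite -ltr_norml normrM ger0_norm//.
by apply: le_lt_trans (ang_ltpi2 c0); rewrite ler_piMl.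
Qed.

Lemma interp_interp s t p q : `|t * ang p q| < pi / 2 -> 0 < cosd p q ->
  interp s p (interp t p q) = interp (s * t) p q.
Proof.
move=> tpi c0; rewrite [interp t p q]interpE// [in RHS]interpE//.
have c' : 0 < cosd p (chart p (t * (px q - px p)) (t * (py q - py p)) (t * ang p q)).
  by rewrite cosd_chart cos_gt0_pihalf// -ltr_norml.
rewrite interpE// ang_chart ?ltW// !chartE; congr chart; ring.
Qed.

Lemma interp1 p q : 0 < cosd p q -> interp 1 p q = q.
Proof. by move=> c0; rewrite interpE// !mul1r chart_ang. Qed.

Lemma cdist_interp_le s t p q : 0 < cosd p q ->
  cdist (interp s p q) (interp t p q) <= 4 * `|s - t| * cdist p q.
Proof.
move=> c0; rewrite !interpE//; apply: (le_trans (cdist_chart_le _ _ _ _ _ _ _)).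
rewrite -!mulrBl !normrM.
have := ler_wpM2l (normr_ge0 (s - t)) (chart_le_cdist c0).
have := mulr_ge0 (normr_ge0 (s - t)) (normr_ge0 (px q - px p)).
have := mulr_ge0 (normr_ge0 (s - t)) (normr_ge0 (py q - py p)).
rewrite !mulrDr; lra.
Qed.

Lemma cdist_interp_ge t p q q' : 0 < t <= 1 -> cdist p q <= 2^-1 -> cdist p q' <= 2^-1 ->
  cdist q q' <= 4 / t * cdist (interp t p q) (interp t p q').
Proof.
move=> /andP[t0 t1] pq pq'.
have c0 : 0 < cosd p q by apply: cdist_cosd; lra.
have c0' : 0 < cosd p q' by apply: cdist_cosd; lra.
rewrite -{1}(chart_ang c0) -{1}(chart_ang c0').
apply: (le_trans (cdist_chart_le _ _ _ _ _ _ _)).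
have hang r : 0 < cosd p r -> cdist p r <= 2^-1 -> `|ang p r| <= 1.
  move=> c1 h; have := chart_le_cdist c1.
  have := normr_ge0 (px r - px p); have := normr_ge0 (py r - py p); lra.
have ha : `|ang p q - ang p q'| <= 2.
  apply: (le_trans (ler_normB _ _)); have := hang _ c0 pq; have := hang _ c0' pq'; lra.
rewrite !interpE//.
have := @cdist_chart_ge p (t * (px q - px p)) (t * (py q - py p)) (t * ang p q)
  (t * (px q' - px p)) (t * (py q' - py p)) (t * ang p q').
rewrite -!mulrBr !normrM (ger0_norm (ltW t0)) => /(_ _)/wrap[].
  by apply: (@le_trans _ _ (1 * 2)); [apply: ler_pM => //; exact: ltW|rewrite mul1r].
set E := cdist _ _; set A := `|_ - _ - _|; set B := `|_ - _ - _|; set C := `|_ - _| => h.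
rewrite mulrAC ler_pdivlMr//.
have : 0 <= t * A by rewrite mulr_ge0 ?normr_ge0 ?(ltW t0).
have : 0 <= t * B by rewrite mulr_ge0 ?normr_ge0 ?(ltW t0).
clearbody E A B C; lra.
Qed.

Lemma sind_lip p q p' q' : `|sind p q - sind p' q'| <= cdist p p' + cdist q q'.
Proof.
have -> : sind p q - sind p' q' = (cth p * (sth q - sth q') + (cth p - cth p') * sth q')
  - (sth p * (cth q - cth q') + (sth p - sth p') * cth q') by rewrite /sind; ring.
have b1 : `|cth p * (sth q - sth q')| <= `|sth q - sth q'|.
  by rewrite normrM ler_piMl// cth_le1.
have b2 : `|(cth p - cth p') * sth q'| <= `|cth p - cth p'|.
  by rewrite normrM ler_piMr// sth_le1.
have b3 : `|sth p * (cth q - cth q')| <= `|cth q - cth q'|.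
  by rewrite normrM ler_piMl// sth_le1.
have b4 : `|(sth p - sth p') * cth q'| <= `|sth p - sth p'|.
  by rewrite normrM ler_piMr// cth_le1.
apply: (le_trans (ler_normB _ _)).
have := ler_normD (cth p * (sth q - sth q')) ((cth p - cth p') * sth q').
have := ler_normD (sth p * (cth q - cth q')) ((sth p - sth p') * cth q').
rewrite /cdist; have := normr_ge0 (px p - px p'); have := normr_ge0 (py p - py p').
have := normr_ge0 (px q - px q'); have := normr_ge0 (py q - py q').
lra.
Qed.

Lemma cosd_lip p q p' q' : `|cosd p q - cosd p' q'| <= cdist p p' + cdist q q'.
Proof.
have -> : cosd p q - cosd p' q' = (cth p * (cth q - cth q') + (cth p - cth p') * cth q')
  + (sth p * (sth q - sth q') + (sth p - sth p') * sth q') by rewrite /cosd; ring.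
have b1 : `|cth p * (cth q - cth q')| <= `|cth q - cth q'|.
  by rewrite normrM ler_piMl// cth_le1.
have b2 : `|(cth p - cth p') * cth q'| <= `|cth p - cth p'|.
  by rewrite normrM ler_piMr// cth_le1.
have b3 : `|sth p * (sth q - sth q')| <= `|sth q - sth q'|.
  by rewrite normrM ler_piMl// sth_le1.
have b4 : `|(sth p - sth p') * sth q'| <= `|sth p - sth p'|.
  by rewrite normrM ler_piMr// sth_le1.
apply: (le_trans (ler_normD _ _)).
have := ler_normD (cth p * (cth q - cth q')) ((cth p - cth p') * cth q').
have := ler_normD (sth p * (sth q - sth q')) ((sth p - sth p') * sth q').
rewrite /cdist; have := normr_ge0 (px p - px p'); have := normr_ge0 (py p - py p').
have := normr_ge0 (px q - px q'); have := normr_ge0 (py q - py q').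
lra.
Qed.

Lemma cdist_chart_base p p' a b c : cdist (chart p a b c) (chart p' a b c) <= 2 * cdist p p'.
Proof.
rewrite {1}/cdist !chartE.
have -> : px p + a - (px p' + a) = px p - px p' by ring.
have -> : py p + b - (py p' + b) = py p - py p' by ring.
have -> : cth p * cos c - sth p * sin c - (cth p' * cos c - sth p' * sin c) =
  (cth p - cth p') * cos c - (sth p - sth p') * sin c by ring.
have -> : sth p * cos c + cth p * sin c - (sth p' * cos c + cth p' * sin c) =
  (sth p - sth p') * cos c + (cth p - cth p') * sin c by ring.
have b1 : `|(cth p - cth p') * cos c| <= `|cth p - cth p'|.
  by rewrite normrM ler_piMr// cos_max.
have b2 : `|(sth p - sth p') * sin c| <= `|sth p - sth p'|.
  by rewrite normrM ler_piMr// sin_max.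
have b3 : `|(sth p - sth p') * cos c| <= `|sth p - sth p'|.
  by rewrite normrM ler_piMr// cos_max.
have b4 : `|(cth p - cth p') * sin c| <= `|cth p - cth p'|.
  by rewrite normrM ler_piMr// sin_max.
have := ler_normB ((cth p - cth p') * cos c) ((sth p - sth p') * sin c).
have := ler_normD ((sth p - sth p') * cos c) ((cth p - cth p') * sin c).
rewrite /cdist; have := normr_ge0 (px p - px p'); have := normr_ge0 (py p - py p').
lra.
Qed.

Lemma ang_continuous p q (e : R) : 0 < cosd p q -> 0 < e -> exists2 r, 0 < r &
  forall p' q', cdist p p' < r -> cdist q q' < r ->
  0 < cosd p' q' /\ `|ang p q - ang p' q'| < e.
Proof.
move=> c0 e0; have /continuous_asin /cvgrPdist_lt /(_ e e0) := sind_lt1 c0.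
move=> /nbhs_ballP[r /= r0 hr].
exists (Num.min r (cosd p q) / 2); first by rewrite divr_gt0// lt_min r0.
move=> p' q' hp hq.
have rr : Num.min r (cosd p q) <= r by rewrite ge_min lexx.
have rc : Num.min r (cosd p q) <= cosd p q by rewrite ge_min lexx orbT.
split.
  by have := cosd_lip p q p' q'; rewrite ler_norml => /andP[_]; lra.
apply: hr; rewrite -ball_normE/=; apply: (le_lt_trans (sind_lip p q p' q')); lra.
Qed.

Lemma interp_continuous (t : R) p q (e : R) : 0 < cosd p q -> 0 < e ->
  exists2 r, 0 < r & forall p' q', cdist p p' < r -> cdist q q' < r ->
  0 < cosd p' q' /\ cdist (interp t p q) (interp t p' q') < e.
Proof.
move=> c0 e0; pose k := 1 + `|t|.
have k0 : 0 < k by rewrite ltr_pwDl.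
have k1 : 1 <= k by rewrite lerDl.
have e'0 : 0 < e / (16 * k) by rewrite divr_gt0// mulr_gt0.
have [r r0 hr] := ang_continuous c0 e'0.
exists (Num.min r (e / (16 * k))); first by rewrite lt_min r0.
move=> p' q'; rewrite !lt_min => /andP[pr pe] /andP[qr qe].
have [c0' ha] := hr _ _ pr qr; split => //.
rewrite !interpE//.
apply: (le_lt_trans (cdist_triangle (chart p (t * (px q' - px p')) (t * (py q' - py p'))
   (t * ang p' q')) _ _)).
have h2 := cdist_chart_base p p' (t * (px q' - px p')) (t * (py q' - py p'))
   (t * ang p' q').
have h1 := cdist_chart_le p (t * (px q - px p)) (t * (py q - py p)) (t * ang p q)
  (t * (px q' - px p')) (t * (py q' - py p')) (t * ang p' q').
rewrite -!mulrBr !normrM in h1.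
set e' := e / (16 * k) in pe qe ha e'0.
have He : e = 16 * (k * e').
  by rewrite mulrA /e' mulrC mulfVK// lt0r_neq0// mulr_gt0.
have tk (x : R) : 0 <= x -> `|t| * x <= k * x by move=> x0; rewrite ler_wpM2r// lerDr.
have bx : `|px q - px p - (px q' - px p')| <= cdist p p' + cdist q q'.
  have -> : px q - px p - (px q' - px p') = (px q - px q') - (px p - px p') by ring.
  apply: (le_trans (ler_normB _ _)); rewrite /cdist.
  have := normr_ge0 (py p - py p'); have := normr_ge0 (py q - py q').
  have := normr_ge0 (cth p - cth p'); have := normr_ge0 (cth q - cth q').
  have := normr_ge0 (sth p - sth p'); have := normr_ge0 (sth q - sth q').
  lra.
have by' : `|py q - py p - (py q' - py p')| <= cdist p p' + cdist q q'.
  have -> : py q - py p - (py q' - py p') = (py q - py q') - (py p - py p') by ring.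
  apply: (le_trans (ler_normB _ _)); rewrite /cdist.
  have := normr_ge0 (px p - px p'); have := normr_ge0 (px q - px q').
  have := normr_ge0 (cth p - cth p'); have := normr_ge0 (cth q - cth q').
  have := normr_ge0 (sth p - sth p'); have := normr_ge0 (sth q - sth q').
  lra.
have g1 : `|t| * `|px q - px p - (px q' - px p')| <= k * (2 * e').
  apply: (le_trans (tk _ (normr_ge0 _))); rewrite ler_pM2l//; lra.
have g2 : `|t| * `|py q - py p - (py q' - py p')| <= k * (2 * e').
  apply: (le_trans (tk _ (normr_ge0 _))); rewrite ler_pM2l//; lra.
have g3 : `|t| * `|ang p q - ang p' q'| <= k * e'.
  apply: (le_trans (tk _ (normr_ge0 _))); rewrite ler_pM2l//; lra.
have g4 : e' <= k * e' by rewrite ler_peMl// ltW.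
lra.
Qed.

End RRS1_geometry.

(** * Metrics locally bi-Lipschitz to the coordinate distance *)

Section pointed_product_topology.
Context (T U : ptopologicalType).
HB.instance Definition _ := Pointed.on (T * U)%type.
End pointed_product_topology.

Definition locally_bilipschitz (R : realType) (D : RRS1 R -> RRS1 R -> \bar R) (K : R) :=
  [/\ 1 <= K,
      forall p q, cdist p q <= K^-1 -> rdist D p q <= K * cdist p q &
      forall p q, rdist D p q < K^-1 -> cdist p q <= K * rdist D p q].

Section locally_euclidean_topology.
Context (R : realType) (D : RRS1 R -> RRS1 R -> \bar R) (dm : is_metric D).
Context (K : R) (bilip : locally_bilipschitz D K).
Local Notation T := (RRS1 R).

Let K1 : 1 <= K. Proof. by case: bilip. Qed.
Let K0 : 0 < K. Proof. exact: lt_le_trans ltr01 K1. Qed.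
Let Ki0 : 0 < K^-1. Proof. by rewrite invr_gt0. Qed.
Let Ki1 : K^-1 <= 1. Proof. by rewrite invf_le1. Qed.
Let up p q : cdist p q <= K^-1 -> rdist D p q <= K * cdist p q.
Proof. by case: bilip => _ h _; exact: h. Qed.
Let lo p q : rdist D p q < K^-1 -> cdist p q <= K * rdist D p q.
Proof. by case: bilip => _ _ h; exact: h. Qed.

Lemma dball_of_cdist p q (r : R) : 0 < r ->
  cdist p q < Num.min K^-1 (r / K) -> dball D p r q.
Proof.
rewrite lt_min => r0 /andP[h1 h2]; rewrite dballE//=.
by apply: (le_lt_trans (up (ltW h1))); rewrite mulrC -ltr_pdivlMr.
Qed.

Lemma cdist_of_dball p q (r : R) : 0 < r ->
  dball D p (Num.min K^-1 (r / K)) q -> cdist p q < r.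
Proof.
move=> r0; rewrite dballE//= lt_min => /andP[h1 h2].
by apply: (le_lt_trans (lo h1)); rewrite mulrC -ltr_pdivlMr.
Qed.

Lemma minK_gt0 (r : R) : 0 < r -> 0 < Num.min K^-1 (r / K).
Proof. by move=> r0; rewrite lt_min Ki0 divr_gt0. Qed.

Lemma dopen_cdistP (U : set T) : dopen D U <->
  forall p, U p -> exists2 r, 0 < r & forall q, cdist p q < r -> U q.
Proof.
split=> [oU p /oU[r [r0 rU]]|oU p /oU[r r0 rU]].
  exists (Num.min K^-1 (r / K)); first exact: minK_gt0.
  by move=> q pq; apply: rU; exact: dball_of_cdist.
exists (Num.min K^-1 (r / K)); split; first exact: minK_gt0.
by move=> q pq; apply: rU; exact: cdist_of_dball.
Qed.

Lemma cdist_chart0 (p : T) a b c : cdist p (chart p a b c) <= `|a| + `|b| + 2 * `|c|.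
Proof.
have := cdist_chart_le p a b c 0 0 0; rewrite chart0 !subr0.
by rewrite cdistC.
Qed.

Lemma no_isolated_points p (r : R) : 0 < r ->
  exists q, dball D p r q /\ 0 < rdist D p q.
Proof.
move=> r0; pose a := Num.min K^-1 (r / K) / 2.
have a0 : 0 < a by rewrite divr_gt0// minK_gt0.
have am : a < Num.min K^-1 (r / K) by have := minK_gt0 r0; rewrite /a; lra.
exists (chart p a 0 0); split.
  apply: dball_of_cdist => //; apply: le_lt_trans am.
  by have := cdist_chart0 p a 0 0; rewrite normr0 mulr0 !addr0 gtr0_norm.
rewrite lt_neqAle rdist_ge0// andbT; apply/eqP => h.
have : D p (chart p a 0 0) = 0%E by rewrite rdistE// -h.
case: dm => _ h0 _ _ /h0 E; move: (congr1 (@px R) E); rewrite px_chart; lra.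
Qed.

Lemma separable_bilipschitz : separable D.
Proof.
pose I := (rat * rat * rat * rat * nat)%type.
pose P (i : I) (p : T) := let: (a, b, c, s, n) := i in
  [/\ `|px p - ratr a| < n.+1%:R^-1, `|py p - ratr b| < n.+1%:R^-1,
      `|cth p - ratr c| < n.+1%:R^-1 & `|sth p - ratr s| < n.+1%:R^-1 :> R].
have /choice[g hg] : forall i, exists p, (exists q, P i q) -> P i p.
  move=> i; have [[q Pq]|no] := pselect (exists q, P i q); first by exists q.
  by exists point => /no.
exists (range g); split.
  by apply: card_le_trans (card_image_le _ _) _; exact: countableP.
move=> x e e0; have m0 := minK_gt0 e0; set m := Num.min _ _ in m0.
pose n := Num.truncn (m / 8)^-1.
have nm : n.+1%:R^-1 < m / 8.
  by rewrite -[ltRHS]invrK ltf_pV2 ?posrE ?invr_gt0 ?divr_gt0// truncnS_gt.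
have n0 : 0 < n.+1%:R^-1 :> R by [].
have near (y : R) : exists q : rat, `|y - ratr q| < n.+1%:R^-1.
  have [q] := @rat_in_itvoo R y (y + n.+1%:R^-1) (ltac:(by rewrite ltrDl)).
  rewrite in_itv/= => /andP[h1 h2]; exists q.
  by rewrite distrC gtr0_norm ?subr_gt0// ltrBlDl.
have [a ha] := near (px x); have [b hb] := near (py x).
have [c hc] := near (cth x); have [s hs] := near (sth x).
have Px : P (a, b, c, s, n) x by split.
exists (g (a, b, c, s, n)); split; first by exists (a, b, c, s, n).
have [ha' hb' hc' hs'] := hg (a, b, c, s, n) (ex_intro _ x Px).
apply: dball_of_cdist => //; rewrite -/m /cdist.
have tr (y z w : R) : `|y - w| < n.+1%:R^-1 -> `|z - w| < n.+1%:R^-1 -> `|y - z| < m / 4.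
  move=> yw zw; apply: (le_lt_trans (ler_distD w y z)); rewrite (distrC w z).
  move: yw zw; move: (n.+1%:R^-1) nm => k; lra.
have := tr _ _ _ ha ha'; have := tr _ _ _ hb hb'.
have := tr _ _ _ hc hc'; have := tr _ _ _ hs hs'.
lra.
Qed.

Definition cube (p : T) (r : R) : set T :=
  [set q | exists a b c, [/\ `|a| <= r, `|b| <= r, `|c| <= r & q = chart p a b c]].

Lemma cube_compact p r : dcompact D (cube p r).
Proof.
move=> F oF cF.
pose sh (v : R * R * R) : T := chart p v.1.1 v.1.2 v.2.
pose B : set (R * R * R) := (`[-r, r] `*` `[-r, r]) `*` `[-r, r].
have cB : compact B.
  by apply: compact_setX; [apply: compact_setX|]; exact: segment_compact.
have {}cB : cover_compact B by rewrite -(@compact_cover (R * R * R)%type).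
have /cB[] : forall U, F U -> open (sh @^-1` U).
- move=> U /oF/dopen_cdistP oU; rewrite openE => -[[a b] c] /= Uabc.
  have [e e0 eU] := oU _ Uabc.
  apply/nbhs_ballP; exists (e / 4) => /=; first by rewrite divr_gt0.
  move=> [[a' b'] c'] [[/= ba bb] bc]; apply: eU.
  move: ba bb bc; rewrite -!ball_normE /= => ba bb bc.
  apply: (le_lt_trans (cdist_chart_le _ _ _ _ _ _ _)); lra.
- move=> [[a b] c] [[/= ra rb] rc].
  have [|U FU Ush] := cF (sh (a, b, c)).
    move: ra rb rc; rewrite !in_itv/= -!ler_norml => ra rb rc.
    by exists a, b, c.
  by exists U.
move=> F' F'F BF'.
exists [set` F']; split; [by move=> U /= UF'; have := F'F _ UF'; rewrite inE|
  exact: finite_fset|].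
move=> q [a [b [c [ra rb rc ->]]]].
have [|U UF' Ush] := BF' (a, b, c); last by exists U.
by split; [split|] => /=; rewrite in_itv/= -ler_norml.
Qed.

Lemma cdist_le_cube p q r : cdist p q <= r -> r <= 1 -> cube p (2 * r) q.
Proof.
move=> pq r1; have c0 : 0 < cosd p q by apply: cdist_cosd; exact: le_trans r1.
exists (px q - px p), (py q - py p), (ang p q); have := chart_le_cdist c0.
have := normr_ge0 (px q - px p); have := normr_ge0 (py q - py p).
have := normr_ge0 (ang p q).
by split; [lra|lra|lra|rewrite chart_ang].
Qed.

Lemma dball_sub_cube p r : 0 < r <= K^-1 -> dball D p r `<=` cube p (2 * K * r).
Proof.
move=> /andP[r0 rK] q; rewrite dballE//= => pq.
have h := lo (lt_le_trans pq rK).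
rewrite -mulrA; apply: cdist_le_cube.
  by apply: (le_trans h); rewrite ler_pM2l// ltW.
by rewrite mulrC -ler_pdivlMr// mul1r.
Qed.

Lemma cube_sub_dball p r : 0 < r <= K^-1 -> cube p (r / (5 * K)) `<=` dball D p r.
Proof.
move=> /andP[r0 rK] q [a [b [c [ra rb rc ->]]]].
have h := cdist_chart0 p a b c.
have e1 : cdist p (chart p a b c) <= 4 * (r / (5 * K)) by lra.
have e2 : 4 * (r / (5 * K)) = 4 / 5 * (r / K).
  by rewrite invfM; field; exact: lt0r_neq0.
have r1 : r / K <= r by rewrite ler_pdivrMr// ler_peMr// ltW.
have rK0 : 0 < r / K by rewrite divr_gt0.
apply: dball_of_cdist => //; rewrite lt_min; apply/andP; split; lra.
Qed.

Lemma locally_compact_bilipschitz : Defs.locally_compact D.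
Proof.
move=> p; exists K^-1; split => //; exists (cube p (2 * K * K^-1)); split.
  exact: cube_compact.
by apply: dball_sub_cube; rewrite Ki0 lexx.
Qed.

End locally_euclidean_topology.

(** * Volume growth and Hausdorff dimension *)

Section cover_ext_facts.
Local Open Scope ereal_scope.
Context (R : realType) (T : Type) (G : set (set T)) (c : set T -> \bar R).
Hypotheses (G0 : G set0) (c0 : c set0 = 0) (c_ge0 : forall A, 0 <= c A).

Lemma cover_ext_le_cost A C : G C -> A `<=` C -> cover_ext G c A <= c C.
Proof.
move=> GC AC; apply: ereal_inf_lbound.
exists (fun k => if k is 0%N then C else set0).
  by split=> [[]//|x /AC Cx]; exists 0%N.
rewrite nneseries_recl//= eseries_cond eseries0 ?adde0// => -[|k]//.
Qed.

Lemma cover_ext_finite_union n (A : nat -> set T) (M : R) :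
  (forall i, (i < n)%N -> cover_ext G c (A i) <= M%:E) ->
  cover_ext G c (\bigcup_(i in `I_n) A i) <= (n%:R * M)%:E.
Proof.
move=> AM; pose B i := if (i < n)%N then A i else set0.
apply: (@le_trans _ _ (cover_ext G c (\bigcup_i B i))).
  by apply: le_cover_ext => x [i /= ilt Ai]; exists i => //; rewrite /B ilt.
apply: (le_trans (cover_ext_sigma_subadditive G c_ge0 B)).
rewrite (nneseries_split _ n); last by move=> *; exact: cover_ext_ge0.
rewrite [X in _ + X]eseries0 ?adde0; last first.
  by move=> k nk _; rewrite /B ltnNge nk/= cover_ext0.
rewrite add0n big_mkord.
apply: (@le_trans _ _ (\sum_(i < n) M%:E)).
  by apply: lee_sum => i _; rewrite /B ltn_ord AM.
by rewrite sumEFin sumr_const card_ord mulr_natl.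
Qed.

End cover_ext_facts.

Section hausdorff_comparison.
Local Open Scope ereal_scope.
Context (R : realType) (T : Type) (d : T -> T -> \bar R) (dm : is_metric d).

Lemma sph_family_haus a : sph_family d a `<=` haus_family d a.
Proof.
move=> C [->|[_]//]; rewrite /haus_family /= /diam.
by rewrite set0X image_set0 ereal_sup0 leNye.
Qed.

Lemma hausdorff_le_sph_haus s A : hausdorff d s A <= sph_haus d s A.
Proof.
apply: ge_ereal_sup => _ [a /= a0 <-].
apply: le_trans (cover_ext_le_sph_haus _ _ _ a0).
by apply: cover_ext_family_le; exact: sph_family_haus.
Qed.

Lemma hcost_exponent (s s' a : R) C : (0 < s < s')%R -> (0 < a)%R ->
  sph_family d a C -> hcost d s' C <= (a `^ (s' - s))%:E * hcost d s C.
Proof.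
move=> /andP[s0 ss'] a0 GC; rewrite /hcost; case: ifPn => [_|/set0P ne].
  by rewrite mule0.
have [_ D0 Da _] := diam_fin_num dm ne (sph_family_haus GC).
move: (fine _) D0 Da => D D0 Da; rewrite -EFinM lee_fin.
have [->|Dn0] := eqVneq D 0%R.
  by rewrite !powR0 ?mulr0// gt_eqF// (lt_trans s0).
have -> : s' = (s' - s + s)%R by ring.
rewrite powRD; last by rewrite Dn0 implybT.
rewrite ler_wpM2r ?powR_ge0// (_ : (s' - s + s - s)%R = (s' - s)%R); last by ring.
by rewrite ge0_ler_powR// ?nnegrE ?(ltW a0)// subr_ge0 ltW.
Qed.

Lemma sph_haus_exponent (s s' : R) A : (0 < s < s')%R -> sph_haus d s A < +oo ->
  sph_haus d s' A = 0.
Proof.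
move=> ss' Afin; apply/eqP; rewrite eq_le outer_measure_ge0 andbT.
have c0 t C : 0 <= hcost d t C by exact: hcost_ge0.
have [s0 s0'] := andP ss'.
pose M := fine (sph_haus d s A).
have AM : sph_haus d s A = M%:E by rewrite /M fineK// ge0_fin_numE// outer_measure_ge0.
have M0 : (0 <= M)%R by rewrite -lee_fin -AM outer_measure_ge0.
apply: ge_ereal_sup => _ [a /= a0 <-]; apply/lee_addgt0Pr => e e0; rewrite add0e.
pose e' := (e / (M + 1))%R.
have M1 : (0 < M + 1)%R by rewrite ltr_wpDl.
have e'0 : (0 < e')%R by rewrite divr_gt0.
pose b := Num.min a (e' `^ (s' - s)^-1)%R.
have b0 : (0 < b)%R by rewrite lt_min a0 powR_gt0.
have be : (b `^ (s' - s) <= e')%R.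
  apply: (@le_trans _ _ ((e' `^ (s' - s)^-1) `^ (s' - s))%R).
    by rewrite ge0_ler_powR// ?nnegrE ?powR_ge0 ?(ltW b0) ?subr_ge0 ?(ltW s0')//
      ge_min lexx orbT.
  rewrite -powRrM mulVf ?powRr1 ?(ltW e'0)//.
  by rewrite subr_eq0 gt_eqF.
apply: (@le_trans _ _ (cover_ext (sph_family d b) (hcost d s') A)).
  by apply: cover_ext_family_le; apply: sph_family_sub; rewrite ge_min lexx.
apply: (@le_trans _ _ ((b `^ (s' - s))%:E * cover_ext (sph_family d b) (hcost d s) A)).
  rewrite -lee_pdivrMl ?powR_gt0//; apply: le_ereal_inf_tmp => _ [F [GF AF] <-].
  rewrite lee_pdivrMl ?powR_gt0// -nneseriesZl//.
  apply: (@le_trans _ _ (\sum_(k <oo) hcost d s' (F k))).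
    by apply: ereal_inf_lbound; exists F.
  by apply: lee_nneseries => // k _; exact: hcost_exponent.
apply: (@le_trans _ _ ((b `^ (s' - s))%:E * M%:E)).
  apply: lee_wpmul2l; first by rewrite lee_fin powR_ge0.
  by rewrite -AM; exact: cover_ext_le_sph_haus.
rewrite -EFinM lee_fin; apply: (@le_trans _ _ (e' * M)%R); first by rewrite ler_wpM2r.
by rewrite /e' mulrAC ler_pdivrMr// ler_wpM2l ?(ltW e0)// lerDl.
Qed.

End hausdorff_comparison.

Section volume.
Context (R : realType) (D : RRS1 R -> RRS1 R -> \bar R) (dm : is_metric D).
Context (K : R) (bilip : locally_bilipschitz D K).
Local Notation T := (RRS1 R).
Implicit Types p q : T.

Let K1 : 1 <= K. Proof. by case: bilip. Qed.
Let K0 : 0 < K. Proof. exact: lt_le_trans ltr01 K1. Qed.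
Let Ki0 : 0 < K^-1. Proof. by rewrite invr_gt0. Qed.
Let up p q : cdist p q <= K^-1 -> rdist D p q <= K * cdist p q.
Proof. by case: bilip => _ h _; exact: h. Qed.
Let lo p q : rdist D p q < K^-1 -> cdist p q <= K * rdist D p q.
Proof. by case: bilip => _ _ h; exact: h. Qed.

Let node (r : R) (N i : nat) : R := - r + 2 * r * i%:R / N%:R.

Let node_near r N a : 0 < r -> (0 < N)%N -> `|a| <= r ->
  exists2 i, (i < N.+1)%N & `|a - node r N i| <= 2 * r / N%:R.
Proof.
move=> r0 N0; rewrite ler_norml => /andP[ra ar].
have N0' : 0 < N%:R :> R by rewrite ltr0n.
pose z := (a + r) * N%:R / (2 * r).
have r2 : 0 < 2 * r by rewrite mulr_gt0.
have z0 : 0 <= z by rewrite divr_ge0 ?(ltW r2)// mulr_ge0 ?ler0n//; lra.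
have /andP[z1 z2] := truncn_itv z0.
have zN : z <= N%:R.
  by rewrite /z ler_pdivrMr// mulrC ler_wpM2l ?ler0n//; lra.
exists (Num.truncn z).
  by rewrite ltnS -(ler_nat R) (le_trans z1).
rewrite /node; set i := (Num.truncn z)%:R in z1 z2 *.
have -> : a - (- r + 2 * r * i / N%:R) = (2 * r / N%:R) * (z - i).
  by rewrite /z; field; rewrite !lt0r_neq0.
rewrite normrM ger0_norm; last by rewrite divr_ge0// ltW.
rewrite ler_piMr ?divr_ge0 ?(ltW r2) ?(ltW N0')// ger0_norm ?subr_ge0//.
by move: z2; rewrite -natr1 -/i; lra.
Qed.

Lemma sph_haus_cube_le p r : 0 < r ->
  (sph_haus D 3 (cube p r) <= ((36 * K * r) ^+ 3)%:E)%E.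
Proof.
move=> r0; apply: ge_ereal_sup => _ [e /= e0 <-].
pose m := Num.min K^-1 e.
have m0 : 0 < m by rewrite lt_min Ki0.
pose N := (Num.truncn (18 * K * r / m)).+1.
have N0 : 0 < N%:R :> R by [].
have Nm : 18 * K * r / N%:R <= m.
  by rewrite ler_pdivrMr// -ler_pdivrMl// mulrC ltW// truncnS_gt.
have KrN : 18 * r / N%:R <= 18 * K * r / N%:R.
  rewrite ler_pM2r ?invr_gt0// mulrAC ler_peMr//.
  by rewrite mulr_ge0// ltW.
pose M := (18 * K * r / N%:R) ^+ 3.
pose rho := 9 * K * r / N%:R.
have rho0 : 0 < rho by rewrite divr_gt0// !mulr_gt0.
have c0 C : (0 <= hcost D 3 C)%E by exact: hcost_ge0.
have G0 : sph_family D e set0 by left.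
have h0 := hcost0 D 3.
pose B i j k := dball D (chart p (node r N i) (node r N j) (node r N k)) rho.
have rho2 : 2 * rho = 18 * K * r / N%:R by rewrite /rho; ring.
have hB i j k : (cover_ext (sph_family D e) (hcost D 3) (B i j k) <= M%:E)%E.
  have [h1 h2] := hcost_ball_le dm (chart p (node r N i) (node r N j) (node r N k)) rho
    (ler0n _ 3).
  apply: (le_trans (cover_ext_le_cost G0 h0 c0 _ (@subset_refl _ _))).
    right; split.
      by exists (chart p (node r N i) (node r N j) (node r N k)), rho.
    apply: (le_trans h2); rewrite lee_fin rho2 (le_trans Nm)//.
    by rewrite ge_min lexx orbT.
  apply: (le_trans h1); rewrite rho2 powR_mulrn// divr_ge0// ?ler0n//.
  by rewrite !mulr_ge0// ltW.
apply: (@le_trans _ _ (cover_ext (sph_family D e) (hcost D 3)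
  (\bigcup_(i in `I_N.+1) \bigcup_(j in `I_N.+1) \bigcup_(k in `I_N.+1) B i j k))).
  apply: le_cover_ext => q [a [b [c [ra rb rc ->]]]].
  have [i iN hi] := @node_near r N a r0 isT ra.
  have [j jN hj] := @node_near r N b r0 isT rb.
  have [k kN hk] := @node_near r N c r0 isT rc.
  exists i => //; exists j => //; exists k => //.
  rewrite /B dballE//= (rdistC dm).
  have hc : cdist (chart p a b c) (chart p (node r N i) (node r N j) (node r N k))
      <= 8 * r / N%:R.
    apply: (le_trans (cdist_chart_le _ _ _ _ _ _ _)).
    by move: hi hj hk; rewrite -!(mulrA _ r); lra.
  have rN0 : 0 < r / N%:R by rewrite divr_gt0.
  have mK : m <= K^-1 by rewrite ge_min lexx.
  have hK : cdist (chart p a b c) (chart p (node r N i) (node r N j) (node r N k)) <= K^-1.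
    apply: (le_trans hc); move: Nm KrN; rewrite -!(mulrA _ r); lra.
  apply: (le_lt_trans (up hK)); rewrite /rho.
  have -> : 9 * K * r / N%:R = K * (9 * r / N%:R) by ring.
  rewrite ltr_pM2l//; apply: (le_lt_trans hc).
  rewrite -!(mulrA _ r); lra.
apply: (@le_trans _ _ ((N.+1%:R * (N.+1%:R * (N.+1%:R * M)))%:E)).
  do 3 (apply: cover_ext_finite_union => // ? _).
rewrite lee_fin /M.
have -> : (36 * K * r) ^+ 3 = (2 * N%:R) * ((2 * N%:R) * ((2 * N%:R) *
   (18 * K * r / N%:R) ^+ 3)).
  by field; exact: lt0r_neq0.
have X0 : 0 <= (18 * K * r / N%:R) ^+ 3.
  by rewrite exprn_ge0// divr_ge0 ?ler0n// !mulr_ge0// ltW.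
have N2 : N.+1%:R <= 2 * N%:R :> R by rewrite -natrM ler_nat mul2n -addnn -addn1 leq_add.
have step (y z : R) : 0 <= y -> y <= z -> N.+1%:R * y <= 2 * N%:R * z.
  by move=> y0 yz; apply: ler_pM.
move: (_ ^+ 3) X0 => X X0.
by do 3 (apply: (step); first by do ?[apply: mulr_ge0 => //]).
Qed.

Lemma lebesgue_measure_segment (a w : R) : 0 <= w ->
  lebesgue_measure (`[a - w, a + w] : set R) = (2 * w)%:E.
Proof.
move=> w0; rewrite lebesgue_measure_itv/= lte_fin; case: ifPn => h.
  by rewrite -EFinB; congr EFin; ring.
by congr EFin; move: h; rewrite -leNgt; lra.
Qed.

Let leb3 := ((@lebesgue_measure R \x @lebesgue_measure R) \x @lebesgue_measure R)%E.

Let box (a b c u w : R) : set (R * R * R) :=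
  (`[a - u, a + u] `*` `[b - u, b + u]) `*` `[c - w, c + w].

Let measurable_box a b c u w : measurable (box a b c u w).
Proof.
by apply: measurableX; [apply: measurableX|]; exact: measurable_itv.
Qed.

Let leb3_box a b c u w : 0 <= u -> 0 <= w ->
  leb3 (box a b c u w) = (8 * u * u * w)%:E.
Proof.
move=> u0 w0; rewrite /leb3 /box product_measure1E//; last first.
  exact: measurableX.
rewrite /= product_measure1E//= !lebesgue_measure_segment//.
by rewrite -!EFinM; congr EFin; ring.
Qed.

Lemma cube_volume_le p r (e : R) (F : nat -> set T) : 0 < r <= 1 -> e < K^-1 ->
  (forall k, diam D (F k) <= e%:E)%E -> cube p r `<=` \bigcup_k F k ->
  ((r ^+ 3)%:E <= \sum_(k <oo) (2 * K ^+ 3)%:E * hcost D 3 (F k))%E.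
Proof.
move=> /andP[r0 r1] eK Fe rF.
pose P k (B : set (R * R * R)) := [/\ measurable B,
  (forall a b c, `|a| <= r -> `|b| <= r -> `|c| <= r -> F k (chart p a b c) -> B (a, b, c)) &
  (leb3 B <= 8%:E * ((2 * K ^+ 3)%:E * hcost D 3 (F k)))%E].
have K30 : 0 <= K ^+ 3 by rewrite exprn_ge0// ltW.
have [B PB] : {B : nat -> set (R * R * R) & forall k, P k (B k)}.
  apply: choice => k.
  have [[q [Fq [a [b [c [ra rb rc qE]]]]]]|no] := pselect (F k `&` cube p r !=set0); last first.
    exists set0; split; [exact: measurable0| |].
      by move=> a b c ra rb rc Fk; apply: no; exists (chart p a b c); split=> //; exists a, b, c.
    rewrite /leb3 measure0; apply: mule_ge0; first by rewrite lee_fin.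
    by apply: mule_ge0; [rewrite lee_fin mulr_ge0|exact: hcost_ge0].
  have [_ d0 de dub] := diam_fin_num dm (ex_intro _ _ Fq) (Fe k).
  set dk := fine _ in d0 de dub.
  have Kd0 : 0 <= K * dk by rewrite mulr_ge0// ltW.
  exists (box a b c (K * dk) (2 * (K * dk))); split; first exact: measurable_box.
    move=> a' b' c' ra' rb' rc' Fq'.
    have qq' := dub _ _ Fq' Fq.
    have h1 := lo (le_lt_trans (le_trans qq' de) eK).
    have h2 : K * rdist D (chart p a' b' c') q <= K * dk by rewrite ler_pM2l.
    have := @cdist_chart_ge _ p a' b' c' a b c.
    rewrite -qE => /(_ _)/wrap[].
      by apply: (le_trans (ler_normB _ _)); lra.
    have := normr_ge0 (a' - a); have := normr_ge0 (b' - b); have := normr_ge0 (c' - c).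
    move=> n1 n2 n3 h3.
    by split; [split|] => /=; rewrite in_itv/= -ler_distl; lra.
  rewrite leb3_box//; last by rewrite mulr_ge0.
  rewrite /hcost; case: ifPn => [/eqP F0|_]; first by rewrite F0 in Fq.
  rewrite -!EFinM lee_fin powR_mulrn// -/dk le_eqVlt; apply/orP; left; apply/eqP; ring.
have sub : box 0 0 0 r r `<=` \bigcup_k B k.
  move=> [[a b] c] [[/=]]; rewrite !in_itv/= !sub0r !add0r -!ler_norml => ra rb rc.
  have [|k _ Fk] := rF (chart p a b c); first by exists a, b, c.
  by exists k => //; case: (PB k) => _ h _; exact: h.
have h : (leb3 (box 0 0 0 r r) <= \sum_(k <oo) leb3 (B k))%E.
  exact: (measure_sigma_subadditive leb3 (fun k => let: And3 m _ _ := PB k in m)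
    (measurable_box 0 0 0 r r) sub).
rewrite leb3_box ?(ltW r0)// in h.
have {h} : ((8 * r * r * r)%:E <= 8%:E * \sum_(k <oo) (2 * K ^+ 3)%:E * hcost D 3 (F k))%E.
  apply: (le_trans h); rewrite -nneseriesZl; last first.
    by move=> *; apply: mule_ge0; [rewrite lee_fin mulr_ge0|exact: hcost_ge0].
  apply: lee_nneseries => [|k _]; first by move=> *; rewrite /leb3 measure_ge0.
  by case: (PB k).
rewrite -lee_pdivrMl// -EFinM; apply: le_trans.
by rewrite lee_fin le_eqVlt; apply/orP; left; apply/eqP; field.
Qed.

Lemma cover_ext_haus_cube_ge p r (e : R) : 0 < r <= 1 -> e < K^-1 ->
  ((r ^+ 3 / (2 * K ^+ 3))%:E <= cover_ext (haus_family D e) (hcost D 3) (cube p r))%E.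
Proof.
move=> r01 eK; apply: le_ereal_inf_tmp => _ [F [GF AF] <-].
have := cube_volume_le r01 eK GF AF.
have K30 : 0 < 2 * K ^+ 3 by rewrite mulr_gt0// exprn_gt0.
rewrite nneseriesZl; last by move=> *; exact: hcost_ge0.
by rewrite -lee_pdivrMl// -EFinM mulrC.
Qed.

Lemma sph_haus_cube_ge p r : 0 < r <= 1 ->
  ((r ^+ 3 / (2 * K ^+ 3))%:E <= sph_haus D 3 (cube p r))%E.
Proof.
move=> r01; have Ki2 : K^-1 / 2 < K^-1 by rewrite ltr_pdivrMr// ltr_pMr//; lra.
apply: (le_trans (cover_ext_haus_cube_ge p r01 Ki2)).
apply: le_trans (hausdorff_le_sph_haus D 3 _).
by apply: ereal_sup_ubound; exists (K^-1 / 2) => //=; rewrite divr_gt0.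
Qed.

Lemma sph_haus_ball_bounds : exists c C : R, [/\ 0 < c, 0 < C &
  forall p r, 0 < r <= K^-1 ->
  ((c * r ^+ 3)%:E <= sph_haus D 3 (dball D p r) <= (C * r ^+ 3)%:E)%E].
Proof.
exists ((5 * K) ^- 3 / (2 * K ^+ 3)), ((36 * K * (2 * K)) ^+ 3); split.
- by rewrite divr_gt0 ?mulr_gt0 ?invr_gt0 ?exprn_gt0 ?mulr_gt0.
- by rewrite exprn_gt0// !mulr_gt0.
move=> p r rK; have /andP[r0 r1] := rK; apply/andP; split.
  apply: (@le_trans _ _ (sph_haus D 3 (cube p (r / (5 * K))))).
    have h : 0 < r / (5 * K) <= 1.
      rewrite divr_gt0 ?mulr_gt0//= ler_pdivrMr ?mulr_gt0// mul1r.
      rewrite (le_trans r1)// (@le_trans _ _ 1) ?invf_le1//; have := K1; lra.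
    apply: le_trans (sph_haus_cube_ge p h).
    rewrite lee_fin le_eqVlt; apply/orP; left; apply/eqP; field.
    by rewrite lt0r_neq0.
  apply: (le_outer_measure (sph_haus D 3)).
  exact: cube_sub_dball.
apply: (@le_trans _ _ (sph_haus D 3 (cube p (2 * K * r)))).
  apply: (le_outer_measure (sph_haus D 3)).
  exact: dball_sub_cube.
apply: (le_trans (sph_haus_cube_le p _)); first by rewrite !mulr_gt0.
by rewrite lee_fin le_eqVlt; apply/orP; left; apply/eqP; ring.
Qed.

Lemma hausdorff_dim3 : hausdorff_dim D = 3%:E.
Proof.
have [e he] := separable_seq dm (separable_bilipschitz dm bilip).
have [c [C [c0 C0 hcC]]] := sph_haus_ball_bounds.
apply/eqP; rewrite eq_le; apply/andP; split.
  apply/lee_addgt0Pr => t t0; rewrite -EFinD; apply: ereal_inf_lbound.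
  exists (3 + t) => //; split; first by rewrite addr_ge0// ltW.
  apply/eqP; rewrite eq_le; apply/andP; split; last first.
    by apply: sup_cover_ge0; exact: hcost_ge0.
  apply: (le_trans (hausdorff_le_sph_haus D (3 + t) _)).
  have -> : [set: T] = \bigcup_i dball D (e i) K^-1.
    apply/seteqP; split=> // x _; have [i xi] := he x _ Ki0.
    by exists i => //; rewrite dballE//= (rdistC dm).
  apply: (le_trans (outer_measure_sigma_subadditive (sph_haus D (3 + t)) _)).
  rewrite eseries0// => i _ _.
  apply: (@sph_haus_exponent _ _ _ dm 3); first by rewrite ltr0n/= ltrDl.
  have /andP[_ h] := hcC (e i) K^-1 (ltac:(by rewrite Ki0 lexx)).
  by apply: (le_lt_trans h); rewrite ltry.
apply: le_ereal_inf_tmp => _ [s [s0 hs] <-]; rewrite lee_fin leNgt; apply/negP => s3.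
pose a := K^-1 / 2.
have a0 : 0 < a by rewrite divr_gt0.
have aK : a < K^-1 by rewrite /a ltr_pdivrMr// ltr_pMr//; lra.
have a1 : a <= 1 by rewrite (le_trans (ltW aK))// invf_le1.
have r01 : 0 < (1 : R) <= 1 by rewrite ltr01 lexx.
have h1 := cover_ext_haus_cube_ge point r01 aK.
have h2 : (cover_ext (haus_family D a) (hcost D 3) (cube point 1) <= hausdorff D s setT)%E.
  apply: (@le_trans _ _ (cover_ext (haus_family D a) (hcost D s) setT)); last first.
    by apply: ereal_sup_ubound; exists a.
  apply: (@le_trans _ _ (cover_ext (haus_family D a) (hcost D 3) setT)).
    exact: le_cover_ext.
  apply: le_ereal_inf_tmp => _ [F [GF AF] <-].
  apply: (@le_trans _ _ (\sum_(k <oo) hcost D 3 (F k))%E).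
    by apply: ereal_inf_lbound; exists F.
  apply: lee_nneseries => [|k _]; first by move=> *; exact: hcost_ge0.
  rewrite /hcost; case: ifPn => // /set0P ne.
  have [_ d0 da _] := diam_fin_num dm ne (GF k).
  move: (fine _) d0 da => d d0 da; rewrite lee_fin.
  have [->|dn0] := eqVneq d 0; first by rewrite powR0 ?powR_ge0// pnatr_eq0.
  have dgt0 : 0 < d by rewrite lt_neqAle eq_sym dn0.
  have -> : d `^ 3 = d `^ s * d `^ (3 - s).
    rewrite -powRD; last by rewrite dn0 implybT.
    by congr powR; ring.
  rewrite ler_piMr ?powR_ge0//; apply: (@le_trans _ _ (1 `^ (3 - s))).
    by rewrite ge0_ler_powR// ?nnegrE// ?subr_ge0 ?(ltW s3)// (le_trans da).
  by rewrite powR1.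
have := le_trans h1 h2; rewrite hs lee_fin leNgt => /negP; apply.
by rewrite divr_gt0// ?mulr_gt0// exprn_gt0.
Qed.

End volume.

(** * The contraction property *)

Section integral_constant_bounds.
Local Open Scope ereal_scope.
Context (disp : measure_display) (T : measurableType disp) (R : realType).
Variable m : {measure set T -> \bar R}.

Lemma integral_mono (f g : T -> \bar R) : (forall x, 0 <= f x <= g x) ->
  \int[m]_x f x <= \int[m]_x g x.
Proof.
move=> fg; rewrite !ge0_integralTE//; last 2 first.
- by move=> x; have /andP[h1 h2] := fg x; exact: le_trans h2.
- by move=> x; have /andP[] := fg x.
apply: ge_ereal_sup => _ [h /= hf <-]; apply: ereal_sup_ubound; exists h => // x.
by apply: (le_trans (hf x)); have /andP[] := fg x.
Qed.

Lemma integral_le_cst (A : set T) (f : T -> \bar R) (k : R) : measurable A ->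
  (forall x, A x -> 0 <= f x <= k%:E) -> \int[m]_(x in A) f x <= k%:E * m A.
Proof.
move=> mA fk.
have [->|/set0P[a Aa]] := eqVneq A set0.
  by rewrite integral_set0 measure0 mule0.
have k0 : 0 <= k%:E by have /andP[h1 h2] := fk _ Aa; exact: le_trans h2.
rewrite -integral_cst// !ge0_integralE//; last first.
  by move=> x /fk/andP[].
apply: ge_ereal_sup => _ [h /= hf <-]; apply: ereal_sup_ubound; exists h => // x.
apply: (le_trans (hf x)); rewrite /patch; case: ifPn => //.
by rewrite inE => /fk/andP[].
Qed.

Lemma integral_ge_cst (A B : set T) (f : T -> \bar R) (k : R) : measurable A ->
  A `<=` B -> (0 <= k)%R -> (forall x, 0 <= f x) -> (forall x, A x -> k%:E <= f x) ->
  k%:E * m A <= \int[m]_(x in B) f x.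
Proof.
move=> mA AB k0 f0 fk.
rewrite -integral_cst// ge0_integralE; last by move=> x _; rewrite /= lee_fin.
rewrite ge0_integralE; last by move=> x _; exact: f0.
apply: ge_ereal_sup => _ [h /= hf <-]; apply: ereal_sup_ubound; exists h => // x.
apply: (le_trans (hf x)); rewrite /patch; case: ifPn => [|_].
  by rewrite inE => Ax; rewrite mem_set ?fk//; exact: AB.
by case: ifPn.
Qed.

End integral_constant_bounds.

Section inv_sqrt_ball_bounds.
Local Open Scope ereal_scope.
Context (R : realType) (T : pointedType) (d : T -> T -> \bar R).
Variable mu : {outer_measure set T -> \bar R}.

Lemma inv_sqrt_ball_ge0 r x : 0 <= inv_sqrt_ball d mu r x.
Proof.
rewrite /inv_sqrt_ball; case: (mu _) => [m| |] //.
by case: ifP => // _; rewrite lee_fin invr_ge0 sqrtr_ge0.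
Qed.

Lemma inv_sqrt_ball_bounds r x (a b : R) : (0 < a)%R ->
  a%:E <= mu (dball d x r) <= b%:E ->
  ((Num.sqrt b)^-1)%:E <= inv_sqrt_ball d mu r x <= ((Num.sqrt a)^-1)%:E.
Proof.
move=> a0; rewrite /inv_sqrt_ball; case: (mu _) => [m| |]; last 2 first.
- by move=> /andP[_]; rewrite leye_eq.
- by rewrite leeNy_eq.
rewrite !lee_fin => /andP[am mb]; have m0 := lt_le_trans a0 am.
rewrite m0 !lee_fin !lef_pV2 ?posrE ?sqrtr_gt0// ?(lt_le_trans m0)//.
by rewrite !ler_wsqrtr.
Qed.

Lemma mu_r_le (r k : R) A : mu.-caratheodory A ->
  (forall y, inv_sqrt_ball d mu r y <= k%:E) -> mu_r d mu r A <= k%:E * mu A.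
Proof.
move=> mA h.
apply: (@integral_le_cst _ (caratheodory_type mu) R
  (mu : set (caratheodory_type mu) -> \bar R) A _ k mA) => y _.
by rewrite inv_sqrt_ball_ge0 h.
Qed.

Lemma mu_r_ge (r k : R) A B : mu.-caratheodory A -> A `<=` B -> (0 <= k)%R ->
  (forall y, k%:E <= inv_sqrt_ball d mu r y) -> k%:E * mu A <= mu_r d mu r B.
Proof.
move=> mA AB k0 h.
apply: (@integral_ge_cst _ (caratheodory_type mu) R
  (mu : set (caratheodory_type mu) -> \bar R) A B _ k mA AB k0) => // y.
exact: inv_sqrt_ball_ge0.
Qed.

Lemma mu_r_ge0 (r : R) A : 0 <= mu_r d mu r A.
Proof.
apply: (@integral_ge0 _ (caratheodory_type mu) R
  (mu : set (caratheodory_type mu) -> \bar R)) => y _.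
exact: inv_sqrt_ball_ge0.
Qed.

End inv_sqrt_ball_bounds.

Section weak_MCP_locally_euclidean.
Context (R : realType) (D : RRS1 R -> RRS1 R -> \bar R) (dm : is_metric D).
Context (K : R) (bilip : locally_bilipschitz D K).
Local Notation T := (RRS1 R).
Local Notation mu := (sph_haus D 3).
Implicit Types p q x y z : T.

Let K1 : 1 <= K. Proof. by case: bilip. Qed.
Let K0 : 0 < K. Proof. exact: lt_le_trans ltr01 K1. Qed.
Let Ki0 : 0 < K^-1. Proof. by rewrite invr_gt0. Qed.
Let up p q : cdist p q <= K^-1 -> rdist D p q <= K * cdist p q.
Proof. by case: bilip => _ h _; exact: h. Qed.
Let lo p q : rdist D p q < K^-1 -> cdist p q <= K * rdist D p q.
Proof. by case: bilip => _ _ h; exact: h. Qed.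

Lemma sph_haus_compact_fin C : dcompact D C -> (mu C < +oo)%E.
Proof.
have [c [c' [c0 c'0 hc]]] := sph_haus_ball_bounds dm bilip.
move=> /(_ [set U | exists x, U = dball D x K^-1])[].
- by move=> _ [x ->]; exact: dopen_ball.
- move=> x _; exists (dball D x K^-1); first by exists x.
  by rewrite dballE//= rdistxx.
move=> F [FB Ffin CF].
apply: (@le_lt_trans _ _ (mu (\bigcup_(U in F) U))); first exact: (le_outer_measure mu).
have /finite_seqP[s sF] := Ffin; rewrite sF in FB *.
elim: s FB {sF CF} => [|U s IH] FB.
  rewrite bigcup0 ?outer_measure0// => V /=.
rewrite (_ : \bigcup_(V in [set` U :: s]) V = U `|` \bigcup_(V in [set` s]) V); last first.
  apply/seteqP; split => x.
    move=> [V /=]; rewrite inE => /orP[/eqP -> ?|Vs Vx]; [by left|by right; exists V].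
  move=> [Ux|[V /= Vs Vx]]; first by exists U; rewrite //= inE eqxx.
  by exists V; rewrite //= inE Vs orbT.
apply: (le_lt_trans (outer_measureU2 mu _ _)).
apply: lte_add_pinfty; last first.
  by apply: IH => V Vs; apply: FB; rewrite /= inE Vs orbT.
have [x ->] : exists x, U = dball D x K^-1 by apply: FB; rewrite /= inE eqxx.
have /andP[_ h] := hc x K^-1 (ltac:(by rewrite Ki0 lexx)).
by apply: (le_lt_trans h); rewrite ltry.
Qed.

Lemma sph_haus_open_gt0 : positive_on_open D mu.
Proof.
have [c [c' [c0 c'0 hc]]] := sph_haus_ball_bounds dm bilip.
move=> U oU [x /oU[r [r0 rU]]].
pose r' := Num.min r K^-1.
have r'0 : 0 < r' by rewrite lt_min r0.
have /andP[h _] := hc x r' (ltac:(by rewrite r'0 ge_min lexx orbT)).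
apply: (@lt_le_trans _ _ (mu (dball D x r'))).
  by apply: lt_le_trans h; rewrite lte_fin mulr_gt0// exprn_gt0.
apply: (le_outer_measure mu); apply: subset_trans rU => y.
by rewrite !dballE//= lt_min => /andP[].
Qed.

Lemma sph_haus_mm_space : mm_space D mu.
Proof.
split => //.
- exact: locally_compact_bilipschitz bilip.
- exact: separable_bilipschitz bilip.
- split; [exact: sph_haus_dborel|exact: sph_haus_regular|exact: sph_haus_compact_fin].
- exact: sph_haus_open_gt0.
Qed.

Lemma prod_open_cdist (O : set (T * T)) :
  (forall p q, O (p, q) -> exists2 r : R, 0 < r & forall p' q',
    cdist p p' < r -> cdist q q' < r -> O (p', q')) ->
  (prod_outer mu).-caratheodory O.
Proof.
move=> oO; apply: (@prod_outer_open _ _ mu _ dm).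
- exact: separable_bilipschitz bilip.
- exact: sph_haus_dborel.
move=> p q /oO[r r0 hr]; exists (Num.min K^-1 (r / K)); split.
  exact: (minK_gt0 bilip r0).
move=> [p' q'] [/= pp' qq'].
by apply: hr; exact: (cdist_of_dball dm bilip).
Qed.

Lemma interp_prod_measurable t : prod_measurable D mu (uncurry (interp t)).
Proof.
move=> U.
pose W : set (T * T) := [set pq | 0 < cosd pq.1 pq.2].
have mW : (prod_outer mu).-caratheodory W.
  apply: prod_open_cdist => p q /= pq.
  have [r r0 hr] := interp_continuous 0 pq ltr01.
  by exists r => // p' q' pp' qq'; case: (hr _ _ pp' qq').
move: U; apply: smallest_sub.
  split.
  - by rewrite /= preimage_set0; exact: caratheodory_measurable_set0.
  - by move=> A mA; rewrite /= setTD preimage_setC; exact: caratheodory_measurable_setC.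
  - by move=> A mA; rewrite /= preimage_bigcup; exact: caratheodory_measurable_bigcup.
move=> U /(dopen_cdistP dm bilip) oU /=.
rewrite (_ : _ @^-1` U = (W `&` (uncurry (interp t) @^-1` U)) `|`
    ((~` W) `&` [set pq | U pq.1])); last first.
  apply/seteqP; split => -[p q] /=; rewrite /interp /W /=; case: ifPn => pq.
  - by move=> ?; left.
  - by move=> ?; right; split => //; apply/negP.
  - by move=> [[]//|[]].
  - by move=> [[] | []].
apply: caratheodory_measurable_setU.
  apply: prod_open_cdist => p q [/= pq /oU[e e0 eU]].
  have [r r0 hr] := interp_continuous t pq e0.
  by exists r => // p' q' pp' qq'; have [? ?] := hr _ _ pp' qq'; split=> //; exact: eU.
apply: caratheodory_measurable_setI; first exact: caratheodory_measurable_setC.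
apply: prod_open_cdist => p q /= /oU[e e0 eU].
by exists e => // p' q' /eU.
Qed.

Lemma dborel_preimage (O : set T) (f : T -> T) : dopen D O ->
  (forall z (e : R), O z -> 0 < e -> exists2 r : R, 0 < r &
     forall z', cdist z z' < r -> cdist (f z) (f z') < e) ->
  forall U, dborel D U -> dborel D (O `&` f @^-1` U).
Proof.
move=> oO cf; apply: smallest_sub.
  split.
  - by rewrite /= preimage_set0 setI0; exact: sigma_algebra0.
  - move=> A mA; rewrite /= setTD preimage_setC.
    have -> : O `&` ~` (f @^-1` A) = O `&` ~` (O `&` f @^-1` A).
      apply/seteqP; split => z [Oz h]; split => //; first by move=> [].
      by move=> Az; apply: h.
    by apply: dborelI; [exact: dborel_open|exact: dborelC].
  - by move=> A mA; rewrite /= preimage_bigcup setI_bigcupr; exact: dborel_bigcup.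
move=> U /(dopen_cdistP dm bilip) oU /=; apply: dborel_open.
apply/(dopen_cdistP dm bilip) => z [Oz /oU[e e0 eU]].
have [r r0 hr] := cf _ _ Oz e0.
have /(dopen_cdistP dm bilip)/(_ z Oz)[r' r'0 hr'] := oO.
exists (Num.min r r'); first by rewrite lt_min r0.
move=> z'; rewrite lt_min => /andP[zr zr'].
by split; [exact: hr'|apply: eU; exact: hr].
Qed.

Lemma dborel_interp_image t x A : 0 < t <= 1 -> A `<=` [set y | 0 < cosd x y] ->
  dborel D A -> dborel D (interp t x @` A).
Proof.
move=> /andP[t0 t1] Ax bA.
have t01 : 0 <= t <= 1 by rewrite ltW.
pose O := [set z | 0 < cosd x z /\ `|ang x z| < t * (pi / 2)].
have oO : dopen D O.
  apply/(dopen_cdistP dm bilip) => z [xz az].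
  have e0 : 0 < t * (pi / 2) - `|ang x z| by rewrite subr_gt0.
  have [r r0 hr] := ang_continuous xz e0.
  exists r => // z' zz'; have [] := hr x z'; rewrite ?cdistxx// => xz' h.
  split => //; rewrite -(subrK (ang x z) (ang x z')).
  by apply: (le_lt_trans (ler_normD _ _)); rewrite -ltrBrDr distrC.
(* interp t^-1 x inverts interp t x on its image, so the image is a preimage. *)
suff -> : interp t x @` A = O `&` interp t^-1 x @^-1` A.
  apply: dborel_preimage => // z e [xz _] e0.
  have [r r0 hr] := interp_continuous t^-1 xz e0.
  by exists r => // z' zz'; have [] := hr x z'; rewrite ?cdistxx.
have tn0 : t != 0 by exact: lt0r_neq0.
apply/seteqP; split => [_ [y Ay <-]|z [[xz az] Az]].
  have xy := Ax _ Ay.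
  have ta : `|t * ang x y| < t * (pi / 2).
    by rewrite normrM (ger0_norm (ltW t0)) ltr_pM2l// ang_ltpi2.
  have tp : `|t * ang x y| < pi / 2.
    by apply: (lt_le_trans ta); rewrite ler_piMl// (le_trans ler01)// pihalf_ge1.
  split; last by rewrite /= interp_interp// mulVf// interp1.
  split; first exact: pos_cosd_interp.
  by rewrite interpE// ang_chart// ltW.
exists (interp t^-1 x z) => //.
rewrite interp_interp// ?mulfV ?interp1//.
by rewrite normrM gtr0_norm ?invr_gt0// mulrC ltr_pdivrMr// mulrC.
Qed.

Lemma borel_kernel x r A : mu.-caratheodory A -> A `<=` dball D x r ->
  (mu (dball D x r) < +oo)%E -> exists A', [/\ dborel D A', A' `<=` A & mu A' = mu A].
Proof.
move=> mA; set X := dball D x r => AX Xfin.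
have [B [bB XB muB]] := sph_haus_regular dm 3 (X `&` ~` A).
have bX : dborel D X by apply: dborel_open; exact: dopen_ball.
exists (X `&` ~` B); split.
- by apply: dborelI => //; exact: dborelC.
- by move=> y [Xy nBy]; apply: contrapT => nAy; apply: nBy; apply: XB.
have e1 : mu X = (mu A + mu (X `&` ~` A))%E.
  by rewrite {1}(mA X) setIC (setIidl AX).
have e2 : mu X = (mu (X `&` ~` A) + mu (X `&` ~` B))%E.
  rewrite {1}(sph_haus_dborel dm 3 bB X); congr (_ + _)%E.
  apply/eqP; rewrite eq_le; apply/andP; split.
    by rewrite muB; apply: (le_outer_measure mu); exact: subIsetr.
  apply: (le_outer_measure mu) => y Xy; split; [by case: Xy|exact: XB].
have fin : mu (X `&` ~` A) \is a fin_num.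
  rewrite ge0_fin_numE ?outer_measure_ge0//; apply: le_lt_trans Xfin.
  by apply: (le_outer_measure mu); exact: subIsetl.
move: e1; rewrite e2 addeC => e1.
by rewrite -(addeK (mu (X `&` ~` B)) fin) e1 addeK.
Qed.

Let Rr : R := (16 * K ^+ 3)^-1.

Let Rr0 : 0 < Rr. Proof. by rewrite invr_gt0 mulr_gt0// exprn_gt0. Qed.

Let K2Rr : 16 * K ^+ 2 * Rr = K^-1.
Proof. by rewrite /Rr; field; exact: lt0r_neq0. Qed.

Let K2_ge : K <= K ^+ 2. Proof. by rewrite expr2 ler_peMl// ltW. Qed.

Let KRr : 16 * K * Rr <= K^-1.
Proof. by rewrite -K2Rr ler_pM2r// ler_pM2l. Qed.

Let RrK : 16 * Rr <= K^-1.
Proof. by apply: le_trans KRr; rewrite ler_pM2r// ler_peMr. Qed.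

Let Ki1 : K^-1 <= 1. Proof. by rewrite invf_le1. Qed.

Let cdist_near x y : rdist D x y < Rr -> cdist x y <= K * rdist D x y /\
  cdist x y <= K^-1 / 16.
Proof.
move=> xy; have h : cdist x y <= K * rdist D x y.
  by apply: lo; move: RrK Rr0; lra.
split => //; apply: (le_trans h).
have : K * rdist D x y <= K * Rr by rewrite ler_pM2l// ltW.
by move: KRr; lra.
Qed.

Let rdist_interp s t x y : 0 <= s <= 1 -> 0 <= t <= 1 -> rdist D x y < Rr ->
  rdist D (interp s x y) (interp t x y) <= 4 * K ^+ 2 * `|s - t| * rdist D x y.
Proof.
move=> /andP[s0 s1] /andP[t0 t1] xy; have [h1 h2] := cdist_near xy.
have c0 : 0 < cosd x y by apply: cdist_cosd; move: Ki1; lra.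
have st : `|s - t| <= 1 by rewrite ler_norml; lra.
have h3 := cdist_interp_le s t c0.
have h4 : `|s - t| * cdist x y <= cdist x y by rewrite ler_piMl// cdist_ge0.
apply: (le_trans (up _)); first by move: Ki0; lra.
have -> : 4 * K ^+ 2 * `|s - t| * rdist D x y =
  K * (4 * `|s - t| * (K * rdist D x y)) by ring.
rewrite ler_pM2l//; apply: (le_trans h3); rewrite ler_wpM2l// mulr_ge0//.
Qed.

Let rdist_interp_ge t x y y' : 0 < t <= 1 -> rdist D x y < Rr -> rdist D x y' < Rr ->
  rdist D y y' <= 4 * K ^+ 2 / t * rdist D (interp t x y) (interp t x y').
Proof.
move=> t01 xy xy'; have /andP[t0 t1] := t01.
have t01' : 0 <= t <= 1 by rewrite ltW.
have z01 : 0 <= (0 : R) <= 1 by rewrite lexx ler01.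
have [h1 h2] := cdist_near xy; have [h1' h2'] := cdist_near xy'.
have small z : rdist D x z < Rr -> rdist D x (interp t x z) <= K^-1 / 4.
  move=> xz; have := rdist_interp z01 t01' xz; rewrite interp0 sub0r normrN.
  rewrite (ger0_norm (ltW t0)) => h; apply: (le_trans h).
  have K2 : 0 < K ^+ 2 by rewrite exprn_gt0.
  have : K ^+ 2 * (t * rdist D x z) <= K ^+ 2 * Rr.
    rewrite ler_pM2l// -[leRHS]mul1r ler_pM ?(ltW t0) ?rdist_ge0// ltW//.
  by move: K2Rr; lra.
have h3 : cdist (interp t x y) (interp t x y') <= K * rdist D (interp t x y) (interp t x y').
  apply: lo; apply: (le_lt_trans (rdist_triangle dm x _ _)).
  rewrite (rdistC dm (interp t x y)); have := small _ xy; have := small _ xy'.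
  by move: Ki0; lra.
have h4 : cdist y y' <= 4 / t * cdist (interp t x y) (interp t x y').
  by apply: cdist_interp_ge => //; move: Ki1; lra.
apply: (le_trans (up _)).
  by apply: (le_trans (cdist_triangle x _ _)); rewrite (cdistC y x); move: Ki0; lra.
have -> : 4 * K ^+ 2 / t * rdist D (interp t x y) (interp t x y') =
  K * (4 / t * (K * rdist D (interp t x y) (interp t x y'))).
  by field; exact: lt0r_neq0.
rewrite ler_pM2l//; apply: (le_trans h4); rewrite ler_wpM2l// divr_ge0// ltW//.
Qed.

Let contraction c C r x A t : 0 < c -> 0 < C ->
  (forall p r, 0 < r <= K^-1 ->
    ((c * r ^+ 3)%:E <= mu (dball D p r) <= (C * r ^+ 3)%:E)%E) ->
  0 < r < Rr -> mu.-caratheodory A -> A `<=` dball D x r -> 0 < t <= 1 ->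
  (mu_r D mu r A * inv_sqrt_ball D mu r x <=
    ((16 * K ^+ 2) ^+ 3 * C / c)%:E *
     (mu_r D mu (r * t) (interp t x @` A) * inv_sqrt_ball D mu (r * t) x))%E.
Proof.
move=> c0 C0 hcC /andP[r0 rR] mA AX t01; have /andP[t0 t1] := t01.
have rK : 0 < r <= K^-1 by rewrite r0 /=; move: RrK Rr0 rR; lra.
have rt0 : 0 < r * t by rewrite mulr_gt0.
have rtr : r * t <= r by rewrite ler_piMr// ltW.
have rtK : 0 < r * t <= K^-1.
  by rewrite rt0 /=; have /andP[_ h] := rK; apply: le_trans h.
have r30 (u : R) : 0 < u -> 0 < c * u ^+ 3 by move=> u0; rewrite mulr_gt0// exprn_gt0.
have C30 (u : R) : 0 < u -> 0 < C * u ^+ 3 by move=> u0; rewrite mulr_gt0// exprn_gt0.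
have Xfin : (mu (dball D x r) < +oo)%E.
  by have /andP[_ h] := hcC x r rK; apply: (le_lt_trans h); rewrite ltry.
have [A' [bA' A'A muA']] := borel_kernel mA AX Xfin.
pose S := interp t x @` A'.
have bS : dborel D S.
  apply: dborel_interp_image => // y /A'A/AX; rewrite dballE//= => xy.
  have [_ h] := cdist_near (lt_trans xy rR).
  by apply: cdist_cosd; move: Ki1; lra.
have mS : mu.-caratheodory S by exact: sph_haus_dborel.
have SA : S `<=` interp t x @` A by move=> _ [y /A'A Ay <-]; exists y.
pose k1 := (Num.sqrt (c * r ^+ 3))^-1; pose k2 := (Num.sqrt (C * (r * t) ^+ 3))^-1.
have k10 : 0 <= k1 by rewrite invr_ge0 sqrtr_ge0.
have k20 : 0 <= k2 by rewrite invr_ge0 sqrtr_ge0.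
have b1 p : (0 <= inv_sqrt_ball D mu r p <= k1%:E)%E.
  by have /andP[_ ->] := inv_sqrt_ball_bounds (r30 _ r0) (hcC p r rK); rewrite inv_sqrt_ball_ge0.
have b2 p : (k2%:E <= inv_sqrt_ball D mu (r * t) p)%E.
  by have /andP[-> _] := inv_sqrt_ball_bounds (r30 _ rt0) (hcC p (r * t) rtK).
have mu0 (B : set T) : (0 <= mu B)%E by exact: outer_measure_ge0.
have i1 : (mu_r D mu r A <= k1%:E * mu A)%E.
  by apply: mu_r_le => // y; have /andP[] := b1 y.
have i2 : (k2%:E * mu S <= mu_r D mu (r * t) (interp t x @` A))%E.
  exact: mu_r_ge.
have L0 : 0 < 4 * K ^+ 2 / t by rewrite divr_gt0// mulr_gt0// exprn_gt0.
have ex : (mu A <= ((16 * K ^+ 2 / t) ^+ 3)%:E * mu S)%E.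
  rewrite -muA'; have := @sph_haus_expand _ _ _ dm 3 A' (interp t x) _ (ler0n _ 3) L0
    (no_isolated_points dm bilip).
  have -> : 4 * (4 * K ^+ 2 / t) = 16 * K ^+ 2 / t by ring.
  rewrite powR_mulrn; last by rewrite divr_ge0 ?(ltW t0)// mulr_ge0// exprn_ge0// ltW.
  apply=> y y' /A'A/AX; rewrite dballE//= => xy /A'A/AX; rewrite dballE//= => xy'.
  by apply: rdist_interp_ge => //; exact: lt_trans rR.
have lhs : (mu_r D mu r A * inv_sqrt_ball D mu r x <= (k1 * k1)%:E * mu A)%E.
  apply: (@le_trans _ _ ((k1%:E * mu A) * k1%:E)%E).
    apply: lee_pmul; [exact: mu_r_ge0|exact: inv_sqrt_ball_ge0|exact: i1|].
    by have /andP[] := b1 x.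
  by rewrite EFinM muleAC.
have rhs : ((k2 * k2)%:E * mu S <= mu_r D mu (r * t) (interp t x @` A) *
    inv_sqrt_ball D mu (r * t) x)%E.
  rewrite EFinM muleAC; apply: lee_pmul; [|by rewrite lee_fin|exact: i2|exact: b2].
  by apply: mule_ge0; [rewrite lee_fin|exact: mu0].
apply: (le_trans lhs).
have Th0 : 0 <= (16 * K ^+ 2) ^+ 3 * C / c.
  by rewrite divr_ge0 ?(ltW c0)// mulr_ge0 ?(ltW C0)// exprn_ge0// mulr_ge0// exprn_ge0// ltW.
apply: (@le_trans _ _ (((16 * K ^+ 2) ^+ 3 * C / c)%:E * ((k2 * k2)%:E * mu S))%E); last first.
  by apply: lee_wpmul2l.
have -> : k1 * k1 = (c * r ^+ 3)^-1.
  by rewrite -expr2 exprVn sqr_sqrtr// ltW// r30.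
have -> : k2 * k2 = (C * (r * t) ^+ 3)^-1.
  by rewrite -expr2 exprVn sqr_sqrtr// ltW// C30.
apply: (@le_trans _ _ ((c * r ^+ 3)^-1%:E * (((16 * K ^+ 2 / t) ^+ 3)%:E * mu S))%E).
  by apply: lee_wpmul2l => //; rewrite lee_fin invr_ge0 ltW// r30.
rewrite !muleA -!EFinM le_eqVlt; apply/orP; left; apply/eqP; congr (_%:E * _)%E.
by field; rewrite !lt0r_neq0.
Qed.

Theorem weak_MCP_of_locally_bilipschitz :
  weak_MCP D (sph_haus D (fine (hausdorff_dim D))) set0.
Proof.
rewrite (hausdorff_dim3 dm bilip) /=.
have [c [C [c0 C0 hcC]]] := sph_haus_ball_bounds dm bilip.
split; [exact: sph_haus_mm_space| |exact: outer_measure0|].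
  by move=> x _; exists 1; split => // y _ [].
move=> Y _ _.
exists Rr, ((16 * K ^+ 2) ^+ 3 * C / c), (4 * K ^+ 2), (@interp R).
split => //.
- by move=> t _; exact: interp_prod_measurable.
- exists set0; split; first exact: (outer_measure0 (prod_outer mu)).
  move=> x y _ _ _; rewrite rdistE// lte_fin => xy s t s01 t01.
  have [_ h] := cdist_near xy.
  have c1 : 0 < cosd x y by apply: cdist_cosd; move: Ki1; lra.
  split; [exact: interp0|exact: interpC| |].
    apply: interp_interp => //; have /andP[t0 t1] := t01.
    by rewrite normrM ger0_norm// (le_lt_trans _ (ang_ltpi2 c1))// ler_piMl.
  rewrite !(rdistE dm) -EFinM lee_fin.
  exact: rdist_interp.
- move=> r r0R; exists set0; split; first exact: outer_measure0.
  move=> x _ _ A mA AX t t01.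
  by apply: contraction => //; apply: subset_trans AX _; exact: subIsetl.
Qed.

End weak_MCP_locally_euclidean.

(** * Estimates for the Gabor family *)

Section real_bounds.
Context (R : realType).
Implicit Types a b x y : R.

Lemma sqr_le_of_norm x y : `|x| <= y -> x ^+ 2 <= y ^+ 2.
Proof.
move=> xy; rewrite -real_normK ?num_real// lerXn2r ?nnegrE//.
exact: le_trans xy.
Qed.

Lemma one_sub_expRN_le x : 1 - expR (- x) <= x.
Proof. by have := expR_ge1Dx (- x); lra. Qed.

Lemma one_sub_expRN_ge x : 0 <= x -> x / (1 + x) <= 1 - expR (- x).
Proof.
move=> x0; have h := expR_ge1Dx x.
have x1 : 0 < 1 + x by lra.
have : expR (- x) <= (1 + x)^-1 by rewrite expRN lef_pV2 ?posrE ?expR_gt0.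
have -> : x / (1 + x) = 1 - (1 + x)^-1 by field; exact: lt0r_neq0.
lra.
Qed.

Lemma expRN_dist_le a b :
  `|expR (- a) - expR (- b)| <= `|a - b| * (expR (- a) + expR (- b)).
Proof.
wlog ab : a b / a <= b => [h|].
  have [|/ltW ba] := leP a b; first exact: h.
  by rewrite distrC (distrC a) [X in _ <= _ * X]addrC; exact: h.
have ea := expR_ge0 (- a); have eb := expR_ge0 (- b).
have E : expR (- b) = expR (- a) * expR (- (b - a)).
  by rewrite -expRD; congr expR; ring.
have d : expR (- a) - expR (- b) = expR (- a) * (1 - expR (- (b - a))).
  by rewrite E; ring.
have le : expR (- b) <= expR (- a) by rewrite ler_expR; lra.
rewrite ger0_norm ?subr_ge0// distrC ger0_norm ?subr_ge0// mulrDr.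
have h1 : expR (- a) - expR (- b) <= expR (- a) * (b - a).
  by rewrite d ler_wpM2l// one_sub_expRN_le.
have h2 : 0 <= (b - a) * expR (- b) by rewrite mulr_ge0// subr_ge0.
lra.
Qed.

Lemma poly_gauss_le (s x y g : R) : 0 < s ->
  g = expR (- (x ^+ 2 + y ^+ 2) / (2 * s ^+ 2)) ->
  (`|x| + `|y| + 2) ^+ 2 * g ^+ 2 <= (8 * s ^+ 2 + 8) * g.
Proof.
move=> s0 gdef; have s20 : 0 < 2 * s ^+ 2 by rewrite mulr_gt0// exprn_gt0.
have g0 : 0 < g by rewrite gdef expR_gt0.
pose t := (x ^+ 2 + y ^+ 2) / (2 * s ^+ 2).
have t0 : 0 <= t by rewrite divr_ge0 ?addr_ge0 ?sqr_ge0// ltW.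
have gE : g = expR (- t) by rewrite gdef mulNr.
have gt : (1 + t) * g <= 1.
  by rewrite gE expRN ler_pdivrMr ?expR_gt0// mul1r expR_ge1Dx.
rewrite expr2 mulrA ler_pM2r//.
apply: (@le_trans _ _ ((8 * s ^+ 2 + 8) * ((1 + t) * g))); last first.
  by rewrite -[leRHS]mulr1 ler_wpM2l//; lra.
rewrite mulrA ler_pM2r//.
have tE : x ^+ 2 + y ^+ 2 = 2 * s ^+ 2 * t.
  by rewrite /t mulrC divfK// lt0r_neq0.
have h : (`|x| + `|y| + 2) ^+ 2 <= 4 * (x ^+ 2 + y ^+ 2) + 8.
  rewrite -(real_normK (num_real x)) -(real_normK (num_real y)).
  have := sqr_ge0 (`|x| - `|y|); have := sqr_ge0 (`|x| + `|y| - 2).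
  move: (`|x|) (`|y|) => u v; rewrite !expr2; lra.
apply: (le_trans h); rewrite tE.
have : 0 <= s ^+ 2 by rewrite sqr_ge0.
have : 0 <= t * 8 by rewrite mulr_ge0.
lra.
Qed.

Lemma signed_interval (m e r : R) : 0 < r -> exists l, forall x, l <= x <= l + r ->
  r * `|e| <= (x - m) * e <= 2 * r * `|e| /\ `|x - m| <= 2 * r.
Proof.
move=> r0; have [e0|e0] := leP 0 e.
  exists (m + r) => x /andP[h1 h2]; rewrite (ger0_norm e0); split.
    by apply/andP; split; apply: ler_wpM2r => //; lra.
  by rewrite ler_norml; apply/andP; split; lra.
exists (m - 2 * r) => x /andP[h1 h2]; rewrite (ltr0_norm e0); split.
  have -> : (x - m) * e = (m - x) * - e by ring.
  by apply/andP; split; apply: ler_wpM2r; lra.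
by rewrite ler_norml; apply/andP; split; lra.
Qed.

End real_bounds.

Section gabor_pointwise.
Context (R : realType) (lam sig : R) (hlam : 0 < lam) (hsig : 0 < sig).
Local Notation T := (RRS1 R).
Implicit Types (p q : T) (z : R * R).

Definition envelope p z : R :=
  expR (- ((z.1 - px p) ^+ 2 + (z.2 - py p) ^+ 2) / (2 * sig ^+ 2)).

Definition phase p z : R :=
  2 * pi / lam * (cth p * (z.1 - px p) + sth p * (z.2 - py p)).

Definition gabor_gap p q z : R :=
  (gabor_re lam sig p z - gabor_re lam sig q z) ^+ 2 +
  (gabor_im lam sig p z - gabor_im lam sig q z) ^+ 2.

Let s20 : 0 < 2 * sig ^+ 2. Proof. by rewrite mulr_gt0// exprn_gt0. Qed.
Let k0 : 0 < 2 * pi / lam. Proof. by rewrite divr_gt0// mulr_gt0// pi_gt0. Qed.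

Lemma gabor_reE p z : gabor_re lam sig p z = cos (phase p z) * envelope p z.
Proof.
rewrite /gabor_re /gabor_arg /phase /envelope /=; congr (cos _ * expR (- _ / _)).
  by rewrite mulrAC.
transitivity ((cth p ^+ 2 + sth p ^+ 2) * ((z.1 - px p) ^+ 2 + (z.2 - py p) ^+ 2)).
  by ring.
by rewrite cth2sth2 mul1r.
Qed.

Lemma gabor_imE p z : gabor_im lam sig p z = sin (phase p z) * envelope p z.
Proof.
rewrite /gabor_im /gabor_arg /phase /envelope /=; congr (sin _ * expR (- _ / _)).
  by rewrite mulrAC.
transitivity ((cth p ^+ 2 + sth p ^+ 2) * ((z.1 - px p) ^+ 2 + (z.2 - py p) ^+ 2)).
  by ring.
by rewrite cth2sth2 mul1r.
Qed.

Lemma gabor_gapE p q z : gabor_gap p q z = (envelope p z - envelope q z) ^+ 2 +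
  2 * envelope p z * envelope q z * (1 - cos (phase p z - phase q z)).
Proof.
rewrite /gabor_gap !gabor_reE !gabor_imE cosB.
set a := envelope p z; set b := envelope q z; set x := phase p z; set y := phase q z.
transitivity ((cos x ^+ 2 + sin x ^+ 2) * a ^+ 2 + (cos y ^+ 2 + sin y ^+ 2) * b ^+ 2
   - 2 * a * b * (cos x * cos y + sin x * sin y)); first by ring.
by rewrite !cos2Dsin2; ring.
Qed.

Lemma envelope_gt0 p z : 0 < envelope p z. Proof. exact: expR_gt0. Qed.

Lemma envelope_le1 p z : envelope p z <= 1.
Proof.
rewrite -[leRHS]expR0 ler_expR mulNr oppr_le0 divr_ge0 ?(ltW s20)//.
by rewrite addr_ge0 ?sqr_ge0.
Qed.

Lemma gabor_gap_ge0 p q z : 0 <= gabor_gap p q z.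
Proof. by rewrite addr_ge0 ?sqr_ge0. Qed.

Lemma gabor_gap_le p q z : gabor_gap p q z <= 4 * (envelope p z + envelope q z).
Proof.
rewrite gabor_gapE; have a0 := envelope_gt0 p z; have b0 := envelope_gt0 q z.
have a1 := envelope_le1 p z; have b1 := envelope_le1 q z.
move: (envelope p z) (envelope q z) a0 b0 a1 b1 => a b a0 b0 a1 b1.
have : 1 - cos (phase p z - phase q z) <= 2 by have := cos_geN1 (phase p z - phase q z); lra.
have ab : 0 <= a * b by rewrite mulr_ge0// ltW.
move=> /(ler_wpM2l ab).
have : a * a <= a by rewrite ler_piMr// ltW.
have : b * b <= b by rewrite ler_piMr// ltW.
have : a * b <= a by rewrite ler_piMr// ltW.
rewrite expr2; lra.
Qed.

Lemma gabor_gap_lip p q z : cdist p q <= 1 ->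
  gabor_gap p q z <= (2 * (8 * sig ^+ 2 + 8) * ((sig ^+ 2)^-1 ^+ 2 + (2 * pi / lam) ^+ 2)) *
    cdist p q ^+ 2 * (envelope p z + envelope q z).
Proof.
move=> E1; rewrite gabor_gapE.
set k := 2 * pi / lam; set E := cdist p q in E1 *.
set a := envelope p z; set b := envelope q z.
have a0 : 0 < a by exact: expR_gt0.
have b0 : 0 < b by exact: expR_gt0.
pose U := z.1 - px p; pose V := z.2 - py p.
pose U' := z.1 - px q; pose V' := z.2 - py q.
pose S := `|U| + `|V|; pose S' := `|U'| + `|V'|.
have S0 : 0 <= S by rewrite addr_ge0.
have E0 : 0 <= E by exact: cdist_ge0.
have UU : U' = U + (px p - px q) by rewrite /U' /U; ring.
have VV : V' = V + (py p - py q) by rewrite /V' /V; ring.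
set d1 := px p - px q in UU; set d2 := py p - py q in VV.
have EE : E = `|d1| + `|d2| + (`|cth p - cth q| + `|sth p - sth q|) by [].
have n1 := normr_ge0 d1; have n2 := normr_ge0 d2.
have n3 := normr_ge0 (cth p - cth q); have n4 := normr_ge0 (sth p - sth q).
have SS' : S <= S' + 1.
  have := ler_normB U' d1; have := ler_normB V' d2.
  rewrite [X in `|X - d1|]UU [X in `|X - d2|]VV !addrK /S /S'; lra.
have pr x y : 0 <= x <= E -> 0 <= y <= S -> x * y <= E * S.
  by move=> /andP[? ?] /andP[? ?]; rewrite ler_pM.
have nU := normr_ge0 U; have nV := normr_ge0 V.
pose al := (U ^+ 2 + V ^+ 2) / (2 * sig ^+ 2); pose be := (U' ^+ 2 + V' ^+ 2) / (2 * sig ^+ 2).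
have aE : a = expR (- al) by rewrite /a /envelope mulNr.
have bE : b = expR (- be) by rewrite /b /envelope mulNr.
have hab : `|al - be| <= E * (S + 1) * (sig ^+ 2)^-1.
  have -> : al - be = (2 * sig ^+ 2)^-1 * (- (d1 * (2 * U + d1) + d2 * (2 * V + d2))).
    by rewrite /al /be UU VV; ring.
  rewrite normrM normrN (gtr0_norm (x := (2 * sig ^+ 2)^-1)) ?invr_gt0//.
  have -> : E * (S + 1) / sig ^+ 2 = (2 * sig ^+ 2)^-1 * (2 * E * (S + 1)).
    by field; exact: lt0r_neq0.
  rewrite ler_pM2l ?invr_gt0//.
  have h1 : `|d1 * (2 * U + d1)| <= `|d1| * (2 * `|U| + 1).
    rewrite normrM ler_wpM2l//; apply: (le_trans (ler_normD _ _)).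
    by rewrite normrM ger0_norm//; lra.
  have h2 : `|d2 * (2 * V + d2)| <= `|d2| * (2 * `|V| + 1).
    rewrite normrM ler_wpM2l//; apply: (le_trans (ler_normD _ _)).
    by rewrite normrM ger0_norm//; lra.
  apply: (le_trans (ler_normD _ _)).
  have h3 : `|d1| * `|U| + `|d2| * `|V| <= E * S.
    rewrite /S mulrDr lerD// ler_wpM2r//; lra.
  lra.
have hph : `|phase p z - phase q z| <= k * (E * (S + 1)).
  have -> : phase p z - phase q z = k * ((cth p - cth q) * U + (sth p - sth q) * V
      - (cth q * d1 + sth q * d2)).
    by rewrite /phase -/k -/U -/V -/U' -/V' UU VV; ring.
  rewrite normrM (gtr0_norm k0) ler_pM2l//.
  apply: (le_trans (ler_normB _ _)).
  have h1 := ler_normD ((cth p - cth q) * U) ((sth p - sth q) * V).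
  have h2 := ler_normD (cth q * d1) (sth q * d2).
  rewrite !normrM in h1 h2.
  have h3 : `|cth q| * `|d1| <= `|d1| by rewrite ler_piMl// cth_le1.
  have h4 : `|sth q| * `|d2| <= `|d2| by rewrite ler_piMl// sth_le1.
  have h5 : `|cth p - cth q| * `|U| + `|sth p - sth q| * `|V| <= E * S.
    rewrite /S mulrDr lerD// ler_wpM2r//; lra.
  lra.
have f1 : (a - b) ^+ 2 <= (E * (S + 1) * (sig ^+ 2)^-1) ^+ 2 * (a + b) ^+ 2.
  rewrite -exprMn; apply: sqr_le_of_norm; rewrite aE bE.
  apply: (le_trans (expRN_dist_le al be)); rewrite -aE -bE ler_wpM2r//; lra.
have f2 : 2 * a * b * (1 - cos (phase p z - phase q z)) <=
    (k * (E * (S + 1))) ^+ 2 * (a + b) ^+ 2.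
  have h1 := one_sub_cos_le (phase p z - phase q z).
  have h2 := sqr_le_of_norm hph.
  have ab0 : 0 <= a * b by rewrite mulr_ge0// ltW.
  apply: (@le_trans _ _ (a * b * (k * (E * (S + 1))) ^+ 2)).
    have := ler_wpM2l ab0 h1; have := ler_wpM2l ab0 h2.
    move: (k * _) (phase p z - phase q z) => Y ph; lra.
  rewrite mulrC ler_wpM2l ?sqr_ge0//.
  by have := sqr_ge0 a; have := sqr_ge0 b; rewrite sqrrD; lra.
have g1 : (S + 1) ^+ 2 * a ^+ 2 <= (8 * sig ^+ 2 + 8) * a.
  apply: le_trans (@poly_gauss_le _ sig U V a hsig erefl); rewrite ler_wpM2r ?sqr_ge0//.
  by apply: sqr_le_of_norm; rewrite ger0_norm /S; lra.
have g2 : (S + 1) ^+ 2 * b ^+ 2 <= (8 * sig ^+ 2 + 8) * b.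
  apply: le_trans (@poly_gauss_le _ sig U' V' b hsig erefl); rewrite ler_wpM2r ?sqr_ge0//.
  by apply: sqr_le_of_norm; rewrite ger0_norm; [rewrite -/S'|]; lra.
set W := (sig ^+ 2)^-1 ^+ 2 + k ^+ 2.
have W0 : 0 <= W by rewrite addr_ge0 ?sqr_ge0.
apply: (@le_trans _ _ (E ^+ 2 * W * ((S + 1) ^+ 2 * (a + b) ^+ 2))).
  rewrite /W; apply: (le_trans (lerD f1 f2)); rewrite le_eqVlt; apply/orP; left.
  by apply/eqP; ring.
have -> : 2 * (8 * sig ^+ 2 + 8) * W * E ^+ 2 * (a + b) =
  E ^+ 2 * W * (2 * ((8 * sig ^+ 2 + 8) * a) + 2 * ((8 * sig ^+ 2 + 8) * b)) by ring.
rewrite ler_wpM2l ?mulr_ge0 ?sqr_ge0//.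
apply: (@le_trans _ _ (2 * ((S + 1) ^+ 2 * a ^+ 2) + 2 * ((S + 1) ^+ 2 * b ^+ 2))).
  have h : (a + b) ^+ 2 <= 2 * a ^+ 2 + 2 * b ^+ 2.
    by have := sqr_ge0 (a - b); rewrite sqrrB sqrrD; lra.
  have := ler_wpM2l (sqr_ge0 (S + 1)) h; lra.
lra.
Qed.

Lemma gabor_gap_lower_position p q : exists l1 l2, forall z,
  l1 <= z.1 <= l1 + 1 -> l2 <= z.2 <= l2 + 1 ->
  (expR (- (4 / sig ^+ 2)) * ((`|px p - px q| + `|py p - py q|) /
     (sig ^+ 2 + (`|px p - px q| + `|py p - py q|)))) ^+ 2 <= gabor_gap p q z.
Proof.
set d1 := px p - px q; set d2 := py p - py q.
have [l1 h1] := signed_interval (px p) d1 ltr01.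
have [l2 h2] := signed_interval (py p) d2 ltr01.
exists l1, l2 => z /h1 [/andP[u1 _] u2] /h2 [/andP[v1 _] v2].
rewrite gabor_gapE.
set U := z.1 - px p in u1 u2; set V := z.2 - py p in v1 v2.
have ss0 : 0 < sig ^+ 2 by rewrite exprn_gt0.
set X := `|d1| + `|d2|.
have X0 : 0 <= X by rewrite addr_ge0.
pose t := X / sig ^+ 2.
have t0 : 0 <= t by rewrite divr_ge0// ltW.
have a0 := envelope_gt0 p z; have b0 := envelope_gt0 q z.
have aL : expR (- (4 / sig ^+ 2)) <= envelope p z.
  rewrite ler_expR mulNr lerN2 ler_pdivrMr//.
  have -> : 4 / sig ^+ 2 * (2 * sig ^+ 2) = 8 by field; exact: lt0r_neq0.
  have := sqr_le_of_norm u2; have := sqr_le_of_norm v2; rewrite -/U -/V.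
  lra.
have bL : envelope q z <= envelope p z * expR (- t).
  rewrite /envelope -expRD ler_expR -!mulNr !mulNr -opprD lerN2.
  have -> : (z.1 - px q) = U + d1 by rewrite /U /d1; ring.
  have -> : (z.2 - py q) = V + d2 by rewrite /V /d2; ring.
  rewrite -/U -/V /t (_ : X / sig ^+ 2 = 2 * X / (2 * sig ^+ 2)); last first.
    by field; exact: lt0r_neq0.
  rewrite -mulrDl ler_pM2r ?invr_gt0//.
  by have := sqr_ge0 d1; have := sqr_ge0 d2; rewrite !sqrrD /X; lra.
have tE : X / (sig ^+ 2 + X) = t / (1 + t).
  by rewrite /t; field; rewrite !lt0r_neq0//= ltr_wpDr.
have e1 := one_sub_expRN_ge t0.
have w0 : 0 <= t / (1 + t) by rewrite divr_ge0//; lra.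
have main : expR (- (4 / sig ^+ 2)) * (X / (sig ^+ 2 + X)) <= envelope p z - envelope q z.
  rewrite tE; apply: (@le_trans _ _ (envelope p z * (1 - expR (- t)))).
    by apply: ler_pM => //; exact: expR_ge0.
  lra.
apply: (@le_trans _ _ ((envelope p z - envelope q z) ^+ 2)).
  apply: sqr_le_of_norm; rewrite ger0_norm// mulr_ge0 ?expR_ge0// tE//.
by rewrite lerDl !mulr_ge0// ?ltW// subr_ge0 cos_le1.
Qed.

Let rho : R := lam / (20 * pi).

Lemma gabor_gap_lower_angle p q :
  2 * (`|px p - px q| + `|py p - py q|) <= rho * (`|cth p - cth q| + `|sth p - sth q|) ->
  exists l1 l2, forall z, l1 <= z.1 <= l1 + rho -> l2 <= z.2 <= l2 + rho ->
  (expR (- (8 * rho ^+ 2 / sig ^+ 2)) / 40 *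
    (`|cth p - cth q| + `|sth p - sth q|)) ^+ 2 <= gabor_gap p q z.
Proof.
have rho0 : 0 < rho by rewrite divr_gt0// mulr_gt0// pi_gt0.
set d1 := px p - px q; set d2 := py p - py q.
set e1 := cth p - cth q; set e2 := sth p - sth q.
set H := `|e1| + `|e2| => small.
have H4 : H <= 4.
  have := ler_normB (cth p) (cth q); have := ler_normB (sth p) (sth q).
  have := cth_le1 p; have := cth_le1 q; have := sth_le1 p; have := sth_le1 q.
  rewrite /H /e1 /e2; lra.
have [l1 h1] := signed_interval (px p) e1 rho0.
have [l2 h2] := signed_interval (py p) e2 rho0.
exists l1, l2 => z /h1 [/andP[u1 u1'] u2] /h2 [/andP[v1 v1'] v2].
rewrite gabor_gapE.
set U := z.1 - px p in u1 u1' u2; set V := z.2 - py p in v1 v1' v2.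
have n1 := normr_ge0 d1; have n2 := normr_ge0 d2.
have ss0 : 0 < sig ^+ 2 by rewrite exprn_gt0.
have H0 : 0 <= H by rewrite addr_ge0.
have rH : rho * H <= rho * 4 by rewrite ler_pM2l.
have UU : z.1 - px q = U + d1 by rewrite /U /d1; ring.
have VV : z.2 - py q = V + d2 by rewrite /V /d2; ring.
have krho : 2 * pi / lam * rho = 10^-1.
  have pn : pi != 0 :> R by rewrite lt0r_neq0 ?pi_gt0.
  have ln : lam != 0 by rewrite lt0r_neq0.
  by rewrite /rho; move: (pi : R) pn => P pn; field; rewrite pn ln.
have HE : rho * H = rho * `|e1| + rho * `|e2| by rewrite /H mulrDr.
pose w := e1 * U + e2 * V - (cth q * d1 + sth q * d2).
have phE : phase p z - phase q z = 2 * pi / lam * w.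
  by rewrite /phase UU VV /w /e1 /e2 -/U -/V; ring.
have hq : `|cth q * d1 + sth q * d2| <= rho * H / 2.
  apply: (le_trans (ler_normD _ _)); rewrite !normrM.
  have : `|cth q| * `|d1| <= `|d1| by rewrite ler_piMl// cth_le1.
  have : `|sth q| * `|d2| <= `|d2| by rewrite ler_piMl// sth_le1.
  lra.
have kr x : 2 * pi / lam * (rho * x) = x / 10 by rewrite (mulrA _ rho x) krho mulrC.
have hw1 : rho * (H / 2) <= w.
  by move: hq; rewrite ler_norml /w (mulrC e1) (mulrC e2) => /andP[_ ?]; lra.
have hw2 : w <= rho * (5 / 2 * H).
  by move: hq; rewrite ler_norml /w (mulrC e1) (mulrC e2) => /andP[? _]; lra.
have rH0 : 0 <= rho * H by rewrite mulr_ge0// ltW.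
have ph1 : H / 20 <= phase p z - phase q z.
  rewrite phE (_ : H / 20 = 2 * pi / lam * (rho * (H / 2))) ?ler_pM2l//.
  by rewrite kr; field.
have ph2 : phase p z - phase q z <= H / 4.
  rewrite phE (_ : H / 4 = 2 * pi / lam * (rho * (5 / 2 * H))) ?ler_pM2l//.
  by rewrite kr; field.
set ph := phase p z - phase q z in ph1 ph2 *.
have ph0 : 0 <= ph by apply: le_trans ph1; rewrite divr_ge0.
have cosb : (H / 20) ^+ 2 / 8 <= 1 - cos ph.
  apply: (@le_trans _ _ (ph ^+ 2 / 8)); last by apply: one_sub_cos_ge; rewrite ger0_norm//; lra.
  rewrite ler_pM2r//; apply: sqr_le_of_norm; rewrite ger0_norm// divr_ge0//.
have dd : `|d1| + `|d2| <= 2 * rho by lra.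
have dsq : d1 ^+ 2 + d2 ^+ 2 <= 4 * rho ^+ 2.
  have := sqr_le_of_norm (x := `|d1| + `|d2|) (y := 2 * rho).
  rewrite ger0_norm ?addr_ge0// => /(_ dd).
  have : 0 <= `|d1| * `|d2| by rewrite mulr_ge0.
  rewrite sqrrD !real_normK ?num_real//; lra.
have hU := sqr_le_of_norm u2; have hV := sqr_le_of_norm v2.
have ab : expR (- (16 * rho ^+ 2 / sig ^+ 2)) <= envelope p z * envelope q z.
  rewrite /envelope UU VV -/U -/V -expRD ler_expR !mulNr -opprD lerN2 -mulrDl.
  rewrite ler_pdivrMr// (_ : 16 * rho ^+ 2 / sig ^+ 2 * (2 * sig ^+ 2) = 32 * rho ^+ 2); last first.
    by field; exact: lt0r_neq0.
  have aux (u v a b r : R) : u ^+ 2 <= (2 * r) ^+ 2 -> v ^+ 2 <= (2 * r) ^+ 2 ->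
      a ^+ 2 + b ^+ 2 <= 4 * r ^+ 2 ->
      u ^+ 2 + v ^+ 2 + ((u + a) ^+ 2 + (v + b) ^+ 2) <= 32 * r ^+ 2.
    by have := sqr_ge0 (u - a); have := sqr_ge0 (v - b); lra.
  exact: aux.
have e2E : expR (- (8 * rho ^+ 2 / sig ^+ 2)) ^+ 2 = expR (- (16 * rho ^+ 2 / sig ^+ 2)).
  by rewrite expr2 -expRD; congr expR; field; exact: lt0r_neq0.
apply: (@le_trans _ _ (2 * envelope p z * envelope q z * (1 - cos ph))); last first.
  by rewrite lerDr sqr_ge0.
have -> (x y : R) : (x / 40 * y) ^+ 2 = 2 * (x ^+ 2 * ((y / 20) ^+ 2 / 8)) by field.
rewrite e2E -(mulrA 2) -(mulrA 2) ler_pM2l//.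
by apply: ler_pM => //; rewrite ?expR_ge0// divr_ge0// sqr_ge0.
Qed.

End gabor_pointwise.

Section gabor_dist_bounds.
Context (R : realType) (lam sig : R) (hlam : 0 < lam) (hsig : 0 < sig).
Local Notation T := (RRS1 R).
Implicit Types (p q : T).
Local Notation leb2 := ((@lebesgue_measure R) \x (@lebesgue_measure R))%E.

Lemma envelopeE p z :
  envelope sig p z = normal_fun (px p) sig z.1 * normal_fun (py p) sig z.2.
Proof.
rewrite /envelope /normal_fun -expRD; congr expR.
by rewrite -mulrDl -opprD (mulrC 2) mulr_natr.
Qed.

Lemma measurable_envelope p : measurable_fun setT (fun z : R * R => (envelope sig p z)%:E).
Proof.
apply/measurable_EFinP.
rewrite (_ : envelope sig p = (normal_fun (px p) sig \o fst) \* (normal_fun (py p) sig \o snd)).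
  by apply: measurable_funM; apply: measurableT_comp => //; exact: measurable_normal_fun.
by apply/funext => z; rewrite envelopeE.
Qed.

Lemma integral_envelope : exists2 J : R, 0 <= J &
  forall p, (\int[leb2]_z (envelope sig p z)%:E = J%:E)%E.
Proof.
have s0 : sig != 0 by exact: lt0r_neq0.
have g0 m (x : R) : (0 <= (normal_fun m sig x)%:E)%E by rewrite lee_fin normal_fun_ge0.
have mg m : measurable_fun setT (fun x : R => (normal_fun m sig x)%:E).
  by apply/measurable_EFinP; exact: measurable_normal_fun.
pose J := (normal_peak sig)^-1.
exists (J * J) => [|p]; first by rewrite mulr_ge0 ?invr_ge0 ?normal_peak_ge0.
have I1 m : (\int[@lebesgue_measure R]_x (normal_fun m sig x)%:E = J%:E)%E.
  have := integral_normal_pdf m sig.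
  rewrite (_ : (fun x => (normal_pdf m sig x)%:E) =
      fun x => (normal_peak sig)%:E * (normal_fun m sig x)%:E)%E; last first.
    by apply/funext => x; rewrite normal_pdfE.
  rewrite ge0_integralZl//; last 2 first.
  - exact: mg.
  - by rewrite lee_fin normal_peak_ge0.
  have pk := normal_peak_gt0 s0.
  have : (0 <= \int[@lebesgue_measure R]_x (normal_fun m sig x)%:E)%E.
    exact: integral_ge0.
  case: (\int[_]_x _)%E => [v| |]//; last by rewrite gt0_muley ?lte_fin.
  rewrite lee_fin -EFinM => _ [] h; congr EFin.
  by rewrite /J -[LHS](mulKf (lt0r_neq0 pk)) h mulr1.
have e0 z : (0 <= (envelope sig p z)%:E)%E by rewrite lee_fin ltW// envelope_gt0.
transitivity (\int[@lebesgue_measure R]_x \int[@lebesgue_measure R]_y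
    (envelope sig p (x, y))%:E)%E.
  exact: (@fubini_tonelli1 _ _ _ _ _ lebesgue_measure lebesgue_measure _
    (measurable_envelope p) e0).
have inner x : (\int[@lebesgue_measure R]_y (envelope sig p (x, y))%:E =
    (normal_fun (px p) sig x)%:E * J%:E)%E.
  rewrite -(I1 (py p)) -ge0_integralZl//; last exact: mg.
  by apply: eq_integral => y _; rewrite envelopeE EFinM.
under eq_integral => x _ do rewrite inner.
rewrite ge0_integralZr//; last 2 first.
- exact: mg.
- by rewrite lee_fin invr_ge0 normal_peak_ge0.
by rewrite I1.
Qed.

Definition gabor_energy p q : R :=
  fine (\int[leb2]_z (gabor_gap lam sig p q z)%:E)%E.

Lemma gabor_distE p q : gabor_dist lam sig p q = Num.sqrt (gabor_energy p q).
Proof. by []. Qed.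

Lemma gabor_energy_le p q M : 0 <= M ->
  (forall z, gabor_gap lam sig p q z <= M * (envelope sig p z + envelope sig q z)) ->
  forall J, (forall p, \int[leb2]_z (envelope sig p z)%:E = J%:E)%E ->
  (\int[leb2]_z (gabor_gap lam sig p q z)%:E <= (M * (2 * J))%:E)%E.
Proof.
move=> M0 hM J hJ.
apply: (@le_trans _ _
  (\int[leb2]_z (M%:E * ((envelope sig p z)%:E + (envelope sig q z)%:E)))%E).
  apply: integral_mono => z; rewrite lee_fin gabor_gap_ge0/=.
  by rewrite -EFinD -EFinM lee_fin.
have e0 p' z : (0 <= (envelope sig p' z)%:E)%E by rewrite lee_fin ltW// envelope_gt0.
rewrite ge0_integralZl//; last 2 first.
- by apply: emeasurable_funD; exact: measurable_envelope.
- by move=> z _; rewrite adde_ge0.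
rewrite ge0_integralD//; [|exact: measurable_envelope..].
by rewrite !hJ -EFinD -EFinM lee_fin mulr2n mulrDl mul1r.
Qed.

Lemma gabor_energyE p q :
  (\int[leb2]_z (gabor_gap lam sig p q z)%:E = (gabor_energy p q)%:E)%E.
Proof.
have [J J0 hJ] := integral_envelope.
rewrite /gabor_energy fineK// ge0_fin_numE; last first.
  by apply: integral_ge0 => z _; rewrite lee_fin gabor_gap_ge0.
apply: le_lt_trans (ltry (4 * (2 * J))).
apply: gabor_energy_le => // z.
exact: gabor_gap_le.
Qed.

Lemma gabor_dist_upper : exists2 C, 0 < C &
  forall p q, cdist p q <= 1 -> gabor_dist lam sig p q <= C * cdist p q.
Proof.
have [J J0 hJ] := integral_envelope.
pose W := 2 * (8 * sig ^+ 2 + 8) * ((sig ^+ 2)^-1 ^+ 2 + (2 * pi / lam) ^+ 2).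
have W0 : 0 <= W.
  rewrite mulr_ge0//; first by have := sqr_ge0 sig; lra.
  by rewrite addr_ge0// sqr_ge0.
exists (Num.sqrt (W * (2 * J)) + 1) => [|p q E1].
  by rewrite ltr_wpDl// sqrtr_ge0.
have E0 := cdist_ge0 p q.
rewrite gabor_distE.
apply: (@le_trans _ _ (Num.sqrt (W * (2 * J) * cdist p q ^+ 2))).
  rewrite ler_wsqrtr// -lee_fin -gabor_energyE mulrAC.
  apply: gabor_energy_le => //; first by rewrite mulr_ge0// sqr_ge0.
  by move=> z; exact: gabor_gap_lip.
rewrite sqrtrM; last by rewrite mulr_ge0// mulr_ge0.
by rewrite sqrtr_sqr ger0_norm// ler_wpM2r// lerDl.
Qed.

Lemma gabor_dist_ge p q (k r l1 l2 : R) : 0 <= k -> 0 < r ->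
  (forall z, l1 <= z.1 <= l1 + r -> l2 <= z.2 <= l2 + r ->
     k ^+ 2 <= gabor_gap lam sig p q z) ->
  k * r <= gabor_dist lam sig p q.
Proof.
move=> k0 r0 hk; rewrite gabor_distE.
have kr0 : 0 <= k * r by rewrite mulr_ge0// ltW.
rewrite -(ger0_norm kr0) -sqrtr_sqr ler_wsqrtr// -lee_fin -gabor_energyE.
pose A : set (R * R) := `[l1, l1 + r] `*` `[l2, l2 + r].
have mA : measurable A by apply: measurableX; exact: measurable_itv.
have AE : leb2 A = (r * r)%:E.
  rewrite /A product_measure1E//= !lebesgue_measure_itv/= !lte_fin !ltrDl r0.
  by rewrite -!EFinB -EFinM; congr (_ * _)%:E; ring.
rewrite exprMn [r ^+ 2]expr2 EFinM -AE.
apply: integral_ge_cst => //.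
- exact: sqr_ge0.
- by move=> z; rewrite lee_fin gabor_gap_ge0.
- by move=> z [/= h1 h2]; rewrite lee_fin hk// -in_itv.
Qed.

Lemma gabor_dist_lower : exists2 c, 0 < c &
  forall p q, c * Num.min (cdist p q) 1 <= gabor_dist lam sig p q.
Proof.
pose rho := lam / (20 * pi).
have rho0 : 0 < rho by rewrite divr_gt0// mulr_gt0// pi_gt0.
pose x1 := expR (- (4 / sig ^+ 2)) / (sig ^+ 2 + 1).
pose x2 := expR (- (8 * rho ^+ 2 / sig ^+ 2)) / 40 * rho.
have ss0 : 0 < sig ^+ 2 by rewrite exprn_gt0.
have x10 : 0 < x1 by rewrite divr_gt0 ?expR_gt0// addr_gt0.
have x20 : 0 < x2 by rewrite mulr_gt0// divr_gt0 ?expR_gt0.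
pose y1 := 1 + 2 / rho; pose y2 := 1 + rho.
have y10 : 1 <= y1 by rewrite lerDl divr_ge0// ltW.
have y20 : 0 < y2 by rewrite addr_gt0.
have y1p : 0 < y1 by exact: lt_le_trans y10.
have q1 : 0 < x1 / y1 by rewrite divr_gt0.
have q2 : 0 < x2 / y2 by rewrite divr_gt0.
exists (Num.min (x1 / y1) (x2 / y2)).
  by rewrite lt_min q1.
move=> p q; set c := Num.min (x1 / y1) _.
have c1 : c <= x1 / y1 by rewrite ge_min lexx.
have c2 : c <= x2 / y2 by rewrite ge_min lexx orbT.
set E := cdist p q; have E0 : 0 <= E by exact: cdist_ge0.
have m0 : 0 <= Num.min E 1 by rewrite le_min E0 ler01.
pose X := `|px p - px q| + `|py p - py q|.
pose H := `|cth p - cth q| + `|sth p - sth q|.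
have EE : E = X + H by [].
have X0 : 0 <= X by rewrite addr_ge0.
have H0 : 0 <= H by rewrite addr_ge0.
have [small|large] := leP (2 * X) (rho * H).
  have [l1 [l2 hl]] := gabor_gap_lower_angle hlam hsig small.
  apply: (@le_trans _ _ (expR (- (8 * rho ^+ 2 / sig ^+ 2)) / 40 * H * rho)); last first.
    by apply: gabor_dist_ge hl.
  rewrite mulrAC -/x2.
  apply: (@le_trans _ _ (x2 / y2 * E)).
    by apply: ler_pM => //; [rewrite le_min !ltW|rewrite ge_min lexx].
  rewrite -mulrA ler_pM2l// mulrC ler_pdivrMr// EE /y2 mulrDr mulr1.
  by rewrite (mulrC H); lra.
have [l1 [l2 hl]] := gabor_gap_lower_position lam hsig p q.
rewrite -/X in hl.
apply: (@le_trans _ _ (expR (- (4 / sig ^+ 2)) * (X / (sig ^+ 2 + X)) * 1)); last first.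
  apply: gabor_dist_ge hl => //.
  by rewrite mulr_ge0 ?expR_ge0// divr_ge0// addr_ge0// ltW.
have Xm : Num.min X 1 / (sig ^+ 2 + 1) <= X / (sig ^+ 2 + X).
  have s1 : 0 < sig ^+ 2 + 1 by rewrite addr_gt0.
  have sX : 0 < sig ^+ 2 + X by rewrite ltr_wpDr.
  rewrite ler_pdivrMr// mulrAC ler_pdivlMr//.
  have [X1|X1] := leP X 1; first by rewrite ler_wpM2l// lerD2l.
  have := ler_wpM2r (ltW ss0) (ltW X1); rewrite !mul1r !mulrDr; lra.
have Em : Num.min E 1 <= y1 * Num.min X 1.
  have HX : H <= 2 / rho * X.
    by rewrite mulrAC ler_pdivlMr// mulrC ltW.
  have [X1|X1] := leP X 1.
    rewrite ge_min EE /y1 mulrDl mul1r; apply/orP; left; lra.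
  by rewrite mulr1 ge_min y10 orbT.
rewrite mulr1; apply: (@le_trans _ _ (x1 / y1 * (y1 * Num.min X 1))).
  apply: ler_pM => //.
  by rewrite le_min !ltW.
rewrite mulrA divfK ?lt0r_neq0//.
by rewrite /x1 mulrAC -mulrA ler_wpM2l// expR_ge0.
Qed.

Lemma gabor_gapC p q : gabor_gap lam sig p q = gabor_gap lam sig q p.
Proof.
by apply/funext => z; rewrite /gabor_gap -sqrrN opprB -[X in _ + X]sqrrN opprB.
Qed.

Lemma gabor_distC p q : gabor_dist lam sig p q = gabor_dist lam sig q p.
Proof. by rewrite !gabor_distE /gabor_energy gabor_gapC. Qed.

End gabor_dist_bounds.

Lemma sum_rev_adjacent (V : nmodType) (f : nat -> nat -> V) N :
  \sum_(j < N) f (N - j)%N (N - j.+1)%N = \sum_(j < N) f j.+1 j.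
Proof.
rewrite (reindex_inj rev_ord_inj) /=; apply: eq_bigr => j _.
by rewrite subKn// subnSK// subKn// ltnW.
Qed.

Section chains.
Context (R : realType) (T : Type) (dist : T -> T -> R) (patch : T -> T -> Prop).
Implicit Types (p q : T).

Definition chain p0 p (e : R) : Prop := exists (N : nat) (q : nat -> T),
  [/\ q 0%N = p0, q N = p, forall j, (j < N)%N -> patch (q j) (q j.+1) &
      e = \sum_(j < N) dist (q j) (q j.+1)].

Lemma chain_rev p0 p e : (forall p q, patch p q -> patch q p) ->
  (forall p q, dist p q = dist q p) -> chain p0 p e -> chain p p0 e.
Proof.
move=> patchC distC [N [q [q0 qN pq ->]]]; exists N, (fun j => q (N - j)%N); split.
- by rewrite subn0.
- by rewrite subnn.
- move=> j jN; apply: patchC; have := pq (N - j.+1)%N.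
  by rewrite subnSK//; apply; exact: leq_subr.
- rewrite (sum_rev_adjacent (fun a b => dist (q a) (q b)) N).
  by apply: eq_bigr => j _; exact: distC.
Qed.

Lemma chain_cat p q r e e' : chain p q e -> chain q r e' -> chain p r (e + e').
Proof.
move=> [N [u [u0 uN pu ->]]] [N' [v [v0 vN pv ->]]].
pose w j := if (j <= N)%N then u j else v (j - N)%N.
have wu j : (j <= N)%N -> w j = u j by rewrite /w => ->.
have wv j : w (N + j)%N = v j.
  rewrite /w; case: ifPn => [|_]; last by rewrite addKn.
  by rewrite -[leqRHS]addn0 leq_add2l leqn0 => /eqP ->; rewrite addn0 uN v0.
exists (N + N')%N, w; split.
- by rewrite wu.
- by rewrite wv.
- move=> j jN; have [jlt|jge] := ltnP j N.
    by rewrite !wu ?(ltnW jlt)//; exact: pu.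
  rewrite -(subnKC jge) -addnS !wv; apply: pv.
  by rewrite ltn_subLR.
- rewrite big_split_ord /=; congr (_ + _); apply: eq_bigr => j _ /=.
    by rewrite !wu// ltnW.
  by rewrite -addnS !wv.
Qed.

Lemma chain1 p q : patch p q -> chain p q (dist p q).
Proof.
move=> h; exists 1%N, (fun j => if j is 0%N then p else q); split => //.
  by case.
by rewrite big_ord1.
Qed.

Lemma chain0 p : chain p p 0.
Proof. by exists 0%N, (fun=> p); split => //; rewrite big_ord0. Qed.

Lemma chain_ge0 p q e : (forall p q, 0 <= dist p q) -> chain p q e -> 0 <= e.
Proof. by move=> d0 [N [u [_ _ _ ->]]]; apply: sumr_ge0 => j _; exact: d0. Qed.

Lemma chain_ge (m : T -> T -> R) p0 p e : (forall p, m p p = 0) ->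
  (forall q p r, m p r <= m p q + m q r) -> (forall p q, m p q <= dist p q) ->
  chain p0 p e -> m p0 p <= e.
Proof.
move=> m0 mtri md [N [q [<- <- _ ->]]].
elim: N => [|N IH]; first by rewrite big_ord0 m0.
rewrite big_ord_recr /=; apply: (le_trans (mtri (q N) _ _)).
by apply: lerD => //; exact: md.
Qed.

End chains.

Section gabor_chains.
Context (R : realType) (lam sig : R) (hlam : 0 < lam) (hsig : 0 < sig).
Local Notation T := (RRS1 R).
Local Notation dist := (gabor_dist lam sig).
Local Notation patch := (gabor_patch lam).
Local Notation gabor_chain := (chain (gabor_dist lam sig) (gabor_patch lam)).
Implicit Types (p q : T).

Lemma gabor_dtildeE p p0 :
  gabor_dtilde lam sig p p0 = ereal_inf [set e%:E | e in gabor_chain p0 p].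
Proof.
congr ereal_inf; apply/seteqP; split => e.
  move=> [N [q [q0 qN pq ->]]]; exists (\sum_(j < N) dist (q j) (q j.+1)) => //.
  by exists N, q.
by move=> [_ [N [q [q0 qN pq ->]]] <-]; exists N, q.
Qed.

Lemma gabor_patchE p0 p : patch p0 p <->
  `|(px p - px p0) * (cth p0 + cth p) + (py p - py p0) * (sth p0 + sth p)| < lam.
Proof.
rewrite /gabor_patch; set x := px p - px p0; set y := py p - py p0.
have -> : (cth p0 * x + sth p0 * y) * (1 + (cth p * cth p0 + sth p * sth p0)) +
    (- sth p0 * x + cth p0 * y) * (sth p * cth p0 - cth p * sth p0) =
  x * (cth p0 + cth p * (cth p0 ^+ 2 + sth p0 ^+ 2)) +
  y * (sth p0 + sth p * (cth p0 ^+ 2 + sth p0 ^+ 2)) by ring.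
by rewrite cth2sth2 !mulr1.
Qed.

Lemma gabor_patchC p q : patch p q -> patch q p.
Proof.
move=> /gabor_patchE h; apply/gabor_patchE.
have -> : (px p - px q) * (cth q + cth p) + (py p - py q) * (sth q + sth p) =
  - ((px q - px p) * (cth p + cth q) + (py q - py p) * (sth p + sth q)) by ring.
by rewrite normrN.
Qed.

Lemma gabor_patch_near p q : 2 * (`|px q - px p| + `|py q - py p|) < lam -> patch p q.
Proof.
move=> h; apply/gabor_patchE; apply: le_lt_trans h.
apply: (le_trans (ler_normD _ _)); rewrite !normrM mulrDr lerD//.
  rewrite mulrC ler_wpM2r// (le_trans (ler_normD _ _))//.
  by have := cth_le1 p; have := cth_le1 q; lra.
rewrite mulrC ler_wpM2r// (le_trans (ler_normD _ _))//.
by have := sth_le1 p; have := sth_le1 q; lra.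
Qed.

Lemma gabor_chain_exists p q : exists e, gabor_chain p q e.
Proof.
pose x := px q - px p; pose y := py q - py p.
pose m : T := ((px q, py q), p.2).
have [e1 c1] : exists e, gabor_chain p m e.
  pose N := (Num.truncn (2 * (`|x| + `|y|) / lam)).+1.
  pose u j : T := ((px p + j%:R * (x / N%:R), py p + j%:R * (y / N%:R)), p.2).
  exists (\sum_(j < N) dist (u j) (u j.+1)), N, u; split => //.
  - by rewrite /u !mul0r !addr0; case: p x y m @N @u => [[]].
  - have N0 : N%:R != 0 :> R by rewrite pnatr_eq0.
    rewrite /u /m /x /y (mulrC N%:R) divfK// (mulrC N%:R) divfK//.
    by rewrite ![_ + (_ - _)]addrC !subrK.
  - move=> j _; apply: gabor_patch_near; rewrite /u /px /py /=.
    have st (a b : R) : a + j.+1%:R * b - (a + j%:R * b) = b by rewrite -natr1; ring.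
    rewrite !st !normrM (@ger0_norm _ N%:R^-1) ?invr_ge0// -mulrDl mulrA.
    by rewrite ltr_pdivrMr// -ltr_pdivrMl// mulrC truncnS_gt.
exists (e1 + dist m q); apply: (chain_cat c1); apply: chain1.
by apply: gabor_patch_near; rewrite /px /py /= !subrr normr0 addr0 mulr0.
Qed.

Lemma gabor_chain_ge (c : R) p0 p e :
  0 < c -> (forall p q, c * Num.min (cdist p q) 1 <= dist p q) ->
  gabor_chain p0 p e -> c * Num.min (cdist p0 p) 1 <= e.
Proof.
move=> c0; apply: (@chain_ge _ _ _ _ (fun p q => c * Num.min (cdist p q) 1)).
  by move=> p'; rewrite cdistxx min_l// mulr0.
move=> q p' r; rewrite -mulrDr ler_pM2l//.
have := cdist_triangle q p' r; have := cdist_ge0 p' q; have := cdist_ge0 q r.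
move: (cdist p' q) (cdist q r) (cdist p' r) => a b d b0 a0 abd.
have [d1|d1] := leP d 1; have [a1|a1] := leP a 1; have [b1|b1] := leP b 1; lra.
Qed.

Lemma gabor_chainC p q e : gabor_chain p q e -> gabor_chain q p e.
Proof.
apply: chain_rev => p' q'; [exact: gabor_patchC|exact: gabor_distC].
Qed.

Lemma gabor_dtilde_le p0 p e : gabor_chain p0 p e -> (gabor_dtilde lam sig p p0 <= e%:E)%E.
Proof. by move=> h; rewrite gabor_dtildeE; apply: ereal_inf_lbound; exists e. Qed.

Lemma gabor_dtilde_ge p0 p (x : R) : (forall e, gabor_chain p0 p e -> x <= e) ->
  (x%:E <= gabor_dtilde lam sig p p0)%E.
Proof.
move=> h; rewrite gabor_dtildeE; apply: le_ereal_inf_tmp => _ [e /h xe <-].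
by rewrite lee_fin.
Qed.

Lemma gabor_dtilde_fin p p0 : gabor_dtilde lam sig p p0 \is a fin_num.
Proof.
have [e he] := gabor_chain_exists p0 p.
rewrite ge0_fin_numE; first by apply: (le_lt_trans (gabor_dtilde_le he)); rewrite ltry.
apply: gabor_dtilde_ge => e'; apply: chain_ge0 => x y.
exact: sqrtr_ge0.
Qed.

Lemma gabor_dtilde_adherent p p0 (x : R) : 0 < x ->
  exists2 e, gabor_chain p0 p e & (e%:E <= gabor_dtilde lam sig p p0 + x%:E)%E.
Proof.
move=> x0; have := gabor_dtilde_fin p p0; rewrite gabor_dtildeE => fin.
have [_ [e he <-] h] := lb_ereal_inf_adherent x0 fin.
by exists e => //; exact: ltW.
Qed.

Lemma gabor_dtilde_metric : is_metric (gabor_dtilde lam sig).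
Proof.
have [c c0 hc] := gabor_dist_lower hlam hsig.
split; first exact: gabor_dtilde_fin.
- move=> x y; split => [h|->]; last first.
    apply/eqP; rewrite eq_le (gabor_dtilde_le (chain0 dist patch y))/=.
    apply: gabor_dtilde_ge => e /(gabor_chain_ge c0 hc); apply: le_trans.
    by rewrite cdistxx min_l// mulr0.
  have : ((c * Num.min (cdist y x) 1)%:E <= gabor_dtilde lam sig x y)%E.
    by apply: gabor_dtilde_ge => e; exact: gabor_chain_ge.
  rewrite h lee_fin pmulr_rle0// ge_min [1 <= 0]lt_geF// orbF => yx.
  by apply/esym/cdist_eq0/eqP; rewrite eq_le yx cdist_ge0.
- move=> x y; rewrite !gabor_dtildeE; congr ereal_inf; apply/seteqP.
  by split=> _ [e /gabor_chainC he <-]; exists e.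
- move=> x y z; apply/lee_addgt0Pr => e e0.
  have e2 : 0 < e / 2 by rewrite divr_gt0.
  have [a ha a1] := gabor_dtilde_adherent x y e2.
  have [b hb b1] := gabor_dtilde_adherent y z e2.
  apply: (le_trans (gabor_dtilde_le (chain_cat hb ha))).
  rewrite EFinD (splitr e) EFinD addeACA addeC.
  exact: leeD.
Qed.

Lemma gabor_dtilde_bilipschitz : exists K, locally_bilipschitz (gabor_dtilde lam sig) K.
Proof.
have [c c0 hc] := gabor_dist_lower hlam hsig.
have [C C0 hC] := gabor_dist_upper hlam hsig.
have dm := gabor_dtilde_metric.
pose K := 1 + C + 3 / lam + c^-1.
have l0 : 0 < 3 / lam by rewrite divr_gt0.
have ci : 0 < c^-1 by rewrite invr_gt0.
have K0 : 0 < K by rewrite /K; lra.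
exists K; split; first by rewrite /K; lra.
- move=> p q pq; have pq0 := cdist_ge0 p q.
  have pq1 : cdist p q <= 1.
    by apply: (le_trans pq); rewrite invf_le1// /K; lra.
  have pql : 2 * cdist p q < lam.
    apply: (@le_lt_trans _ _ (2 * K^-1)); first by rewrite ler_pM2l.
    rewrite ltr_pdivrMr// mulrC -ltr_pdivrMr//.
    by rewrite /K (_ : 2 / lam = 3 / lam - lam^-1) //; [have : 0 < lam^-1 by rewrite invr_gt0|]; lra.
  have pt : patch q p.
    apply: gabor_patch_near; apply: le_lt_trans pql; rewrite ler_pM2l// /cdist.
    by have := normr_ge0 (cth p - cth q); have := normr_ge0 (sth p - sth q); lra.
  rewrite -lee_fin -rdistE//; apply: (le_trans (gabor_dtilde_le (chain1 dist pt))).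
  rewrite lee_fin gabor_distC (le_trans (hC _ _ pq1))// ler_wpM2r// /K; lra.
- move=> p q pq.
  have h : c * Num.min (cdist p q) 1 <= rdist (gabor_dtilde lam sig) p q.
    rewrite -lee_fin -rdistE// cdistC.
    by apply: gabor_dtilde_ge => e; exact: gabor_chain_ge.
  have m1 : Num.min (cdist p q) 1 < 1.
    rewrite -(ltr_pM2l c0) mulr1; apply: (le_lt_trans h); apply: (lt_le_trans pq).
    by rewrite -[leRHS]invrK lef_pV2 ?posrE// /K; lra.
  move: h; rewrite min_l; last by move: m1; rewrite gt_min ltxx orbF => /ltW.
  rewrite mulrC -ler_pdivlMr// => h; apply: (le_trans h); rewrite mulrC.
  by rewrite ler_wpM2r ?rdist_ge0// /K; lra.
Qed.

End gabor_chains.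

Theorem theorem3 (R : realType) (lam sig : R) (hlam : 0 < lam) (hsig : 0 < sig) :
  weak_MCP (gabor_dtilde lam sig) (gabor_mu lam sig) set0.
Proof.
have [K bilip] := gabor_dtilde_bilipschitz hlam hsig.
exact: (weak_MCP_of_locally_bilipschitz (gabor_dtilde_metric hlam hsig) bilip).
Qed.
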